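(* Let $t<n/2$ and let $x_1,\dots,x_F$ be real numbers such that $\sum_{j=1}^F x_j P_{\lambda^{(i)},\rho^{(j)}} = 1$ for $i=1$ and $=\zeta$ for $1<i\le F$. Then the eigenvalue of $\sum_{j=1}^F x_jA_{\rho^{(j)}}$ on $S^{2(n-t,1^t)}$ satisfies \[\eta_{(n-t,1^t)} = \sum_{j=1}^F x_j P_{(n-t,1^t),\rho^{(j)}} = \zeta.\]
   Context: $\mathcal{M}_{2n}$ is the set of perfect matchings of $K_{2n}$. For $m,m'\in\mathcal{M}_{2n}$ the multigraph union $m\cup m'$ is a disjoint union of even cycles (a common edge is a $2$-cycle); listing cycle lengths as $2\rho_1\ge2\rho_2\ge\dots$ gives the cycle type $d(m,m')=\rho\vdash n$. For $\rho\vdash n$ the associate $A_\rho$ is the 0/1 matrix indexed by $\mathcal{M}_{2n}$ with $(A_\rho)_{m,m'}=1$ iff $d(m,m')=\rho$. $\mathbb{R}[\mathcal{M}_{2n}]$ decomposes multiplicity-freely as $\bigoplus_{\lambda\vdash n}S^{2\lambda}$ (irreducible $S_{2n}$-modules indexed by $2\lambda=(2\lambda_1,2\lambda_2,\dots)$), and $P_{\lambda,\rho}$ is the eigenvalue of $A_\rho$ on $S^{2\lambda}$. Partitions of $n$ are ordered reverse-lexicographically ($\mu\le\lambda$ iff $\mu=\lambda$ or $\mu_j<\lambda_j$ at the first differing index $j$); $\lambda\vdash n$ is fat if $\lambda\ge(n-t,1^t)$. $F_t$ is the number of fat partitions of $n$, $F=F_t-1$, and $\lambda^{(1)}>\dots>\lambda^{(F)}$,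 $\rho^{(1)}>\dots>\rho^{(F)}$ both denote the first $F$ partitions of $n$ in reverse-lexicographic order (the fat partitions other than $(n-t,1^t)$). $\zeta=-1/\big((2n-1)(2n-3)\cdots(2n-2t+1)-1\big)$. *)

(* Defs.v *)
From HB Require Import structures.
From mathcomp Require Import all_boot all_order ssralg fingroup perm.

Set Implicit Arguments.
Unset Strict Implicit.
Unset Printing Implicit Defensive.

Import GRing.Theory.
Local Open Scope ring_scope.

Definition is_partition (n : nat) (lam : seq nat) : bool :=
  [&& sorted geq lam, all (fun a => 0 < a)%N lam & sumn lam == n].

Fixpoint revlex_gt (lam mu : seq nat) : bool :=
  match lam, mu with
  | a :: lam', b :: mu' => (b < a)%N || ((a == b) && revlex_gt lam' mu')
  | a :: _, [::] => (0 < a)%N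
  | [::], _ => false
  end.

Definition hook (n t : nat) : seq nat := (n - t)%N :: nseq t 1%N.

Definition dbl_part (lam : seq nat) : seq nat := [seq (2 * a)%N | a <- lam].

Definition zeta {R : fieldType} (n t : nat) : R :=
  - ((\prod_(k < t) (2 * n - 1 - 2 * k))%N%:R - 1)^-1.

(* a perfect matching is encoded as a fixed-point-free involution of the
   vertex set 'I_N (i is matched with m i) *)
Definition is_pm (N : nat) (m : {perm 'I_N}) : bool :=
  [forall i, (m i != i) && (m (m i) == i)].

Definition matching (N : nat) := {m : {perm 'I_N} | is_pm m}.

(* cycle type d(m,m'): the connected components of the multigraph m ∪ m'
   are the even cycles; a component with 2 rho_i vertices contributes
   rho_i; parts are listed in nonincreasing order. *)
Definition cycle_type (N : nat) (m m' : matching N) : seq nat :=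
  let e := [rel i j : 'I_N | (val m i == j) || (val m' i == j)] in
  let comps : {set {set 'I_N}} := [set [set j | connect e i j] | i : 'I_N] in
  sort geq (map (fun C : {set 'I_N} => (#|C| %/ 2)%N) (enum comps)).

Definition assoc_op (R : pzRingType) (N : nat) (rho : seq nat)
    (f : {ffun matching N -> R}) : {ffun matching N -> R} :=
  [ffun m => \sum_(m' | cycle_type m m' == rho) f m'].

Lemma is_pm_conj (N : nat) (g m : {perm 'I_N}) :
  is_pm m -> is_pm (g^-1 * m * g)%g.
Proof.
rewrite /is_pm => /forallP H; apply/forallP=> i; rewrite !permM.
have /andP[H1 /eqP H2] := H (g^-1%g i).
rewrite permK H2 permKV eqxx andbT.
apply/eqP => E; move/eqP: H1; apply.
by rewrite -{2}E permK.
Qed.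

(* g . m : the matching {g i, g (m i)} *)
Definition mact (N : nat) (g : {perm 'I_N}) (m : matching N) : matching N :=
  exist _ (g^-1 * val m * g)%g (is_pm_conj g (valP m)).

Definition fact (R : pzRingType) (N : nat) (g : {perm 'I_N})
    (f : {ffun matching N -> R}) : {ffun matching N -> R} :=
  [ffun m => f (mact g^-1 m)].

Definition scalef (R : pzRingType) (N : nat) (c : R)
    (f : {ffun matching N -> R}) : {ffun matching N -> R} :=
  [ffun m => c * f m].

(* cell (row, column) of entry k in the row-reading standard filling of the
   Young diagram of shape mu *)
Fixpoint cell (mu : seq nat) (k : nat) : nat * nat :=
  match mu with
  | [::] => (0%N, k)
  | a :: mu' => if (k < a)%N then (0%N, k)
                else let rc := cell mu' (k - a) in (rc.1.+1, rc.2)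
  end.

Definition rowstab (N : nat) (mu : seq nat) (p : {perm 'I_N}) : bool :=
  [forall i : 'I_N, (cell mu (p i)).1 == (cell mu i).1].

Definition colstab (N : nat) (mu : seq nat) (q : {perm 'I_N}) : bool :=
  [forall i : 'I_N, (cell mu (q i)).2 == (cell mu i).2].

Definition yst (R : pzRingType) (N : nat) (mu : seq nat)
    (f : {ffun matching N -> R}) : {ffun matching N -> R} :=
  \sum_(p : {perm 'I_N} | rowstab mu p)
     fact p (\sum_(q : {perm 'I_N} | colstab mu q)
               scalef ((-1) ^+ odd_perm q) (fact q f)).

(* v lies in S^mu ⊆ R[M_N], the mu-isotypic component of R[M_N], i.e. the
   S_N-submodule generated by c_T R[M_N]  (= R[S_N] c_T R[S_N] . R[M_N]).
   Since R[M_{2n}] is multiplicity-free this is the copy of S^mu. *)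
Definition in_specht (R : pzRingType) (N : nat) (mu : seq nat)
    (v : {ffun matching N -> R}) : Prop :=
  exists f : {perm 'I_N} -> {ffun matching N -> R},
    v = \sum_(g : {perm 'I_N}) fact g (yst mu (f g)).

(* Main.v *)
(* The operator A = sum_j x_j A_{rho_j} is self-adjoint and commutes with S_{2n}.
   No rho_j has t or more parts equal to 1, so A(m, m') = 0 as soon as m and m'
   share t edges; hence <v, A v> = 0 for the indicator v of the matchings that
   contain t fixed disjoint edges.  Being fixed by S_{2n-2t}, v has components
   only in the S^{2 lambda} with lambda fat, and A acts on these by 1, zeta, ...,
   zeta and eta.  The component in the trivial module has squared norm |v|^2 / D
   with D = (2n-1)(2n-3)...(2n-2t+1), and 1/D + zeta (1 - 1/D) = 0, so what is
   left of <v, A v> = 0 is (eta - zeta) |v_hook|^2 = 0 with v_hook <> 0.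

   The support of v comes from highest weight vectors: a nonzero submodule
   containing a vector fixed by a Young subgroup contains a nonzero y fixed by a
   Young subgroup of a lexicographically maximal shape.  Maximality makes all
   raising operators vanish on y; this forces the rows of the shape to be even
   in the matching module, and makes the column antisymmetrizer nonzero on y. *)
Require Import Defs.
From HB Require Import structures.
From mathcomp Require Import all_boot all_order ssralg ssrnum fingroup perm.
From mathcomp Require Import zify ring.

Set Implicit Arguments.
Unset Strict Implicit.
Unset Printing Implicit Defensive.

Import GRing.Theory Num.Theory.
Local Open Scope ring_scope.

(** * Column antisymmetrizers on highest weight vectors *)

Section ColumnAntisymmetrizer.

Context (R : realFieldType) (V : lmodType R) (T : finType).
Context (act : {perm T} -> {linear V -> V}).
Context (act1 : forall y, act 1%g y = y).
Context (actM : forall p q y, act p (act q y) = act (p * q)%g y).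

(* The second clause says that the raising operators moving b to row i kill y. *)
Definition highest_weight (r : T -> nat) (y : V) : Prop :=
  (forall a b, r a = r b -> act (tperm a b) y = y) /\
  (forall i b, (i < r b)%N -> \sum_(a | r a == i) act (tperm a b) y = - y).

Lemma eq_highest_weight (r r' : T -> nat) y :
  r =1 r' -> highest_weight r y -> highest_weight r' y.
Proof.
move=> rr' [yrow yraise]; split => [a b|i b]; rewrite -!rr'; first exact: yrow.
by move=> /yraise <-; apply: eq_bigl => a; rewrite rr'.
Qed.

Definition col_group (c : T -> nat) (S : {set T}) : pred {perm T} :=
  fun q => perm_on S q && [forall x, c (q x) == c x].

(** Letting [S] grow one point at a time interpolates between the identity ([S] empty) and the full
    column antisymmetrizer. *)
Definition antisym (c : T -> nat) (S : {set T}) (y : V) : V :=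
  \sum_(q | col_group c S q) (-1) ^+ odd_perm q *: act q y.

Lemma antisym0 c y : antisym c set0 y = y.
Proof.
rewrite /antisym (big_pred1 1%g) ?odd_perm1 ?scale1r ?act1 // => q.
rewrite /col_group /=; apply/andP/eqP => [[qS _]|->].
  by apply/permP => x; rewrite perm1 (out_perm qS) ?inE.
by split; [exact: perm_on1 | apply/forallP => x; rewrite perm1].
Qed.

Lemma antisym_sum c S I (s : seq I) (Q : pred I) (F : I -> V) :
  antisym c S (\sum_(i <- s | Q i) F i) = \sum_(i <- s | Q i) antisym c S (F i).
Proof.
rewrite /antisym exchange_big /=; apply: eq_bigr => q _.
by rewrite linear_sum /= scaler_sumr.
Qed.

Lemma antisymD c S y z : antisym c S (y + z) = antisym c S y + antisym c S z.
Proof.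
rewrite /antisym -big_split /=; apply: eq_bigr => q _.
by rewrite linearD scalerDr.
Qed.

Lemma antisymN c S y : antisym c S (- y) = - antisym c S y.
Proof.
by rewrite /antisym -sumrN; apply: eq_bigr => q _; rewrite linearN scalerN.
Qed.

Lemma char0_oppr_eq (z : V) : z = - z -> z = 0.
Proof.
move=> zN; have : 2%:R *: z = 0 by rewrite scaler_nat mulr2n {1}zN addNr.
by move=> /eqP; rewrite scaler_eq0 pnatr_eq0 => /eqP.
Qed.

(** Right multiplication by [tperm a b] permutes the column group, flips the sign and leaves the
    translated vector unchanged, so the sum is its own negative. *)
Lemma antisym_fixed_eq0 c (S : {set T}) a b y :
    a \in S -> b \in S -> a != b -> c a = c b -> act (tperm a b) y = y ->
  antisym c S y = 0.
Proof.
move=> aS bS ab cab yfix; apply: char0_oppr_eq.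
rewrite -{1}yfix /antisym -sumrN.
rewrite [RHS](reindex_inj (mulIg (tperm a b))) /=.
have inv q : col_group c S q -> col_group c S (q * tperm a b)%g.
  move=> /andP[qS /forallP qc]; apply/andP; split.
    apply: perm_onM => //; apply/subsetP => x; rewrite inE.
    by case: tpermP => [->|->|_ _] //; rewrite eqxx.
  apply/forallP => x; rewrite permM; rewrite -(eqP (qc x)).
  by case: tpermP => [->|->|_ _] //; rewrite cab.
apply: eq_big => [q|q _].
  apply/idP/idP => [/inv //|/inv].
  by rewrite -mulgA tperm2 mulg1.
by rewrite actM odd_permM odd_tperm ab signr_addb expr1 mulrN1 scaleNr opprK.
Qed.

(** Coset decomposition of the column group of [x |: S] over the subgroup fixing [x], sorted by
    [b = q x]. The representative for [b != x] is the odd permutation [tperm x b], hence the minus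
    sign. *)
Lemma antisym_add c (S : {set T}) x y : x \notin S ->
  antisym c (x |: S) y =
  antisym c S (y - \sum_(b in S | c b == c x) act (tperm x b) y).
Proof.
move=> xS; rewrite antisymD antisymN antisym_sum -sumrN.
rewrite {1}/antisym.
rewrite (partition_big (fun q : {perm T} => q x)
   (fun b => (b \in x |: S) && (c b == c x))) /=; last first.
  move=> q /andP[qS /forallP/(_ x) ->]; rewrite andbT.
  by rewrite (perm_closed _ qS) setU11.
rewrite (bigD1 x) ?setU11 ?eqxx //=; congr (_ + _).
  rewrite /antisym; apply: eq_bigl => q; rewrite /col_group -!andbA.
  case: forallP => //= qc; rewrite ?andbF // ?andbT.
  apply/andP/idP => [[qS /eqP qx]|qS].
    apply/subsetP => z; rewrite inE => qz.
    have := subsetP qS z; rewrite inE qz => /(_ isT).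
    by rewrite in_setU1 => /orP[/eqP zx|//]; move: qz; rewrite zx qx eqxx.
  split; last by rewrite (out_perm qS).
  by apply: (subset_trans qS); rewrite subsetUr.
apply: eq_big => [b|b].
  rewrite in_setU1; case: eqVneq => [->|] /=; first by rewrite (negbTE xS) andbF.
  by rewrite andbT.
move=> /andP[/andP[bxS /eqP cb] bx].
have bS : b \in S by move: bxS; rewrite in_setU1 (negbTE bx).
rewrite (reindex_inj (mulIg (tperm x b))) /antisym -sumrN /=.
apply: eq_big => [q|q _]; last first.
  rewrite actM odd_permM odd_tperm eq_sym bx signr_addb expr1 mulrN1.
  by rewrite scaleNr.
have tc z : c (tperm x b z) = c z by case: tpermP => [->|->|_ _].
rewrite /col_group.
have -> : [forall z, c ((q * tperm x b)%g z) == c z] = [forall z, c (q z) == c z].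
  by apply: eq_forallb => z; rewrite permM tc.
case: forallP => //= qc; rewrite ?andbF // ?andbT permM.
apply/andP/idP => [[qS /eqP qx]|qS].
  have qxx : q x = x by rewrite -(tpermK x b (q x)) qx tpermR.
  apply/subsetP => z; rewrite inE => qz.
  case: (eqVneq z x) qz => [->|zx qz]; first by rewrite qxx eqxx.
  apply/negPn/negP => zS.
  have := subsetP qS z; rewrite inE in_setU1 (negbTE zS) (negbTE zx) /= permM.
  have qzx : q z != x by rewrite -[X in _ != X]qxx (inj_eq perm_inj).
  case: tpermP => [e|e|_ _]; first by rewrite e eqxx in qzx.
    have xz : x != z by rewrite eq_sym.
    by move/(_ xz).
  by move/(_ qz).
split; last by rewrite (out_perm qS) ?tpermL.
apply: perm_onM; first by apply: (subset_trans qS); rewrite subsetUr.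
apply/subsetP => z; rewrite inE in_setU1.
by case: tpermP => [->|->|_ _]; rewrite ?eqxx ?bS ?orbT.
Qed.

Lemma antisym_comm c (S : {set T}) a b y : a \notin S -> b \notin S ->
  act (tperm a b) (antisym c S y) = antisym c S (act (tperm a b) y).
Proof.
move=> aS bS; rewrite /antisym linear_sum /=; apply: eq_bigr => q /andP[qS _].
rewrite linearZ /= !actM; congr (_ *: act _ y).
apply/permP => z; rewrite !permM.
have qa : q a = a by rewrite (out_perm qS).
have qb : q b = b by rewrite (out_perm qS).
case: (tpermP a b z) => [->|->|za zb]; rewrite ?qa ?qb ?tpermL ?tpermR //.
rewrite tpermD //; first by rewrite -qa (inj_eq perm_inj) eq_sym; apply/eqP.
by rewrite -qb (inj_eq perm_inj) eq_sym; apply/eqP.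
Qed.

(** The relation at [x] is carried to every [a] in the row of [x] weakly to its right, and summed
    over these [a]. The raising relations then turn the sum into a positive multiple of
    [antisym c S y]. *)
Lemma highest_weight_antisym_step (r c : T -> nat) (S : {set T}) x y :
    highest_weight r y ->
    (forall b k, (k < c b)%N -> exists b', r b' = r b /\ c b' = k) ->
    (forall z, (z \in S) = (c z < c x)%N || ((c z == c x) && (r x < r z)%N)) ->
  antisym c (x |: S) y = 0 -> antisym c S y = 0.
Proof.
move=> [yrow yraise] left_just memS ySx.
have notS a : r a = r x -> (c x <= c a)%N -> a \notin S.
  by move=> ra ca; rewrite memS ra ltnn andbF orbF -leqNgt.
have xS : x \notin S by apply: notS.
pose C := [pred b in S | c b == c x].
have each a : (r a == r x) && (c x <= c a)%N ->
    antisym c S y - \sum_(b | C b) antisym c S (act (tperm a b) y) = 0.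
  move=> /andP[/eqP ra ca]; have aS := notS a ra ca.
  have := congr1 (act (tperm x a)) ySx.
  rewrite linear0 antisym_add // antisym_comm // => e; rewrite -[RHS]e.
  rewrite linearB /= (yrow x a) // (linear_sum (act _)) /= antisymD antisymN antisym_sum.
  congr (_ - _); apply: eq_bigr => b /andP[bS _]; congr (antisym _ _ _).
  rewrite actM -[in LHS](yrow x a) // actM; congr (act _ y).
  have -> : tperm a b = (tperm x b ^ tperm x a)%g.
    rewrite tpermJ tpermL tpermD //; first by apply: contraNneq xS => ->.
    by apply: contraNneq aS => ->.
  by rewrite conjgE tpermV -!mulgA tperm2 mulg1.
(* In the raising relation for [b], an [a] strictly left of [x] contributes nothing: the point [b']
   in the row of [b] and the column of [a] lies in [S] with [a], and [tperm a b'] fixes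
   [act (tperm a b) y]. *)
have each_b b : C b ->
    \sum_(a | (r a == r x) && (c x <= c a)%N) antisym c S (act (tperm a b) y)
      = - antisym c S y.
  move=> /andP[/= bS /eqP cb].
  have rb : (r x < r b)%N by move: bS; rewrite memS cb ltnn eqxx.
  have := congr1 (antisym c S) (yraise _ _ rb).
  rewrite (bigID (fun a => (c x <= c a)%N)) /= antisymD antisymN !antisym_sum.
  rewrite [X in _ + X]big1 ?addr0 // => a /andP[/eqP ra].
  rewrite -ltnNge => ca.
  have [b' [rb' cb']] := left_just b (c a) (leq_trans ca (eq_leq (esym cb))).
  have b'b : b' != b by apply/eqP => e; move: ca; rewrite -cb' e cb ltnn.
  have ab' : a != b' by apply/eqP => e; move: rb; rewrite -ra e rb' ltnn.
  have ab : a != b by apply/eqP => e; move: rb; rewrite -ra e ltnn.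
  apply: (@antisym_fixed_eq0 _ _ a b') => //; rewrite ?memS ?cb' ?ca //.
  rewrite actM -[in RHS](yrow b b' (esym rb')) actM.
  have -> : tperm b b' = (tperm a b' ^ tperm a b)%g.
    by rewrite tpermJ tpermL tpermD // eq_sym.
  by rewrite conjgE tpermV !mulgA tperm2 mul1g.
have : \sum_(a | (r a == r x) && (c x <= c a)%N)
    (antisym c S y - \sum_(b | C b) antisym c S (act (tperm a b) y)) = 0.
  by apply: big1.
rewrite sumrB [X in _ - X]exchange_big /=.
rewrite [X in _ - X](eq_bigr (fun=> - antisym c S y)); last exact: each_b.
rewrite sumrN opprK.
(* The coefficient is the number of such [a] plus the number of [b] in [C]; it is nonzero because
   [a = x] counts. *)
rewrite !sumr_const -mulrnDr => /eqP; rewrite -scaler_nat scaler_eq0 pnatr_eq0.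
rewrite addn_eq0 => /orP[/andP[/eqP n0 _]|/eqP //].
have : x \in [pred a | (r a == r x) && (c x <= c a)%N] by rewrite inE eqxx leqnn.
by rewrite (card0_eq n0).
Qed.

Theorem highest_weight_antisym_eq0 (r c : T -> nat) y :
    highest_weight r y -> injective (fun x => (r x, c x)) ->
    (forall b k, (k < c b)%N -> exists b', r b' = r b /\ c b' = k) ->
  antisym c setT y = 0 -> y = 0.
Proof.
move=> hy rc_inj left_just.
pose K := (\max_x r x).+1.
have rK x : (r x < K)%N by rewrite ltnS leq_bigmax.
(* points are ordered column by column, from bottom to top in each column *)
pose key x := (c x * K + (K.-1 - r x))%N.
have key_lt z x :
    (key z < key x)%N = (c z < c x)%N || ((c z == c x) && (r x < r z)%N).
  rewrite /key; have := rK x; have := rK z.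
  case: (ltngtP (c z) (c x)) => [cc|cc|->] /=; [nia|nia|lia].
pose S k := [set z | (key z < k)%N].
have step k : antisym c (S k.+1) y = 0 -> antisym c (S k) y = 0.
  case: (pickP (fun x => key x == k)) => [x /eqP xk|nox].
    have -> : S k.+1 = x |: S k.
      apply/setP => z; rewrite !inE ltnS leq_eqVlt -xk; congr (_ || _).
      apply/eqP/eqP => [e|-> //].
      have := key_lt z x; have := key_lt x z; rewrite e ltnn.
      by move=> h1 h2; apply: rc_inj; congr (_, _); lia.
    by apply: (highest_weight_antisym_step hy left_just) => z; rewrite inE -xk key_lt.
  suff -> : S k.+1 = S k by [].
  by apply/setP => z; rewrite !inE ltnS leq_eqVlt (nox z).
have all k : antisym c (S k) y = 0 -> y = 0.
  elim: k => [|k IH /step/IH //].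
  have -> : S 0%N = set0 by apply/setP => z; rewrite !inE ltn0.
  by rewrite antisym0.
move=> yT; apply: (all (\max_x key x).+1).
rewrite (_ : S _ = setT) //.
by apply/setP => z; rewrite !inE ltnS leq_bigmax.
Qed.

End ColumnAntisymmetrizer.

(** * The matching module *)

Section MatchingModule.

Context (R : realFieldType) (N : nat).
Local Notation M := (matching N).
Local Notation V := {ffun M -> R^o}.

Lemma matchingK (m : M) x : val m (val m x) = x.
Proof. by have /forallP/(_ x)/andP[_ /eqP] := valP m. Qed.

Lemma matching_neq (m : M) x : val m x != x.
Proof. by have /forallP/(_ x)/andP[] := valP m. Qed.

Lemma mactE (g : {perm 'I_N}) (m : M) x :
  val (mact g m) (g x) = g (val m x).
Proof. by rewrite !permM permK. Qed.

Lemma mact1 (m : M) : mact 1%g m = m.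
Proof. by apply: val_inj; rewrite /= invg1 mul1g mulg1. Qed.

Lemma mactM (p q : {perm 'I_N}) (m : M) : mact (p * q)%g m = mact q (mact p m).
Proof. by apply: val_inj; rewrite /= invMg !mulgA. Qed.

Lemma mactK (p : {perm 'I_N}) : cancel (@mact N p) (mact p^-1).
Proof. by move=> m; rewrite -mactM mulgV mact1. Qed.

Lemma mactKV (p : {perm 'I_N}) : cancel (mact p^-1) (@mact N p).
Proof. by move=> m; rewrite -mactM mulVg mact1. Qed.

(** Evaluating at [mact p m] gives a left action for the left-to-right product of permutations;
    [fact g] is then [pact g^-1]. *)
Definition translate (p : {perm 'I_N}) (y : V) : V := [ffun m => y (mact p m)].

Lemma translate_is_linear p : linear (translate p).
Proof. by move=> a y z; apply/ffunP => m; rewrite !ffunE. Qed.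

HB.instance Definition _ p :=
  GRing.isLinear.Build R V V _ (translate p) (translate_is_linear p).

Definition pact (p : {perm 'I_N}) : {linear V -> V} := translate p.

Lemma pactE p y m : pact p y m = y (mact p m).
Proof. by rewrite ffunE. Qed.

Lemma pact1 y : pact 1%g y = y.
Proof. by apply/ffunP => m; rewrite pactE mact1. Qed.

Lemma pactM p q y : pact p (pact q y) = pact (p * q)%g y.
Proof. by apply/ffunP => m; rewrite !pactE mactM. Qed.

Lemma mact_tperm_partner (m : M) c : mact (tperm c (val m c)) m = m.
Proof.
apply: val_inj; rewrite /= tpermV -mulgA.
suff -> : (val m * tperm c (val m c) = tperm c (val m c) * val m)%g.
  by rewrite mulgA tperm2 mul1g.
by rewrite [RHS]conjgC tpermJ matchingK tpermC.
Qed.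

(** Conjugation by [m] exchanges the two transpositions, and they commute. This can trade a
    transposition across rows for one inside a row. *)
Lemma mact_tperm_swap (m : M) a c : a != c ->
  mact (tperm a (val m c)) m = mact (tperm c (val m a)) m.
Proof.
move=> ac; apply: val_inj; rewrite /= !tpermV.
set s := tperm a _; set t := tperm c _.
have sm : (s * val m = val m * t)%g.
  by rewrite conjgC tpermJ matchingK tpermC.
have tm : (t * val m = val m * s)%g.
  by rewrite conjgC tpermJ matchingK tpermC.
rewrite sm tm -!mulgA [(s * t)%g]conjgC.
have mac : val m a != val m c by rewrite (inj_eq perm_inj).
by rewrite tpermJ !tpermD // ?matching_neq // eq_sym // matching_neq.
Qed.

(* Swapping a with the partner b of c trades a crossing edge at c for the edge
   {a, c}; if a itself lies on a crossing edge, two crossing edges disappear. *)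
Lemma highest_weight_matching_eq0 (r : 'I_N -> nat) (y : V) :
    highest_weight pact r y ->
    (forall m : M, ~ (forall x, r (val m x) = r x)) ->
  y = 0.
Proof.
move=> [yrow yraise] no_internal.
pose K := (\max_x r x).+1.
have rK x : (r x < K)%N by rewrite ltnS leq_bigmax.
(* Rows with label below [k] are already matched internally. The outer induction is on the number of
   rows left, the inner one on the number of vertices of row [k] whose partner lies in another
   row. *)
suff H j k (m : M) : (K - k <= j)%N ->
    (forall x, (r x < k)%N -> r (val m x) = r x) -> y m = 0.
  by apply/ffunP => m; rewrite ffunE; apply: (H K 0%N); rewrite ?subn0.
elim: j k m => [|j IHj] k m.
  rewrite leqn0 subn_eq0 => kK mk; case: (no_internal m) => x.
  by apply: mk; apply: leq_trans kK.
move=> kj; pose cross (m : M) := [set x | (r x == k) && (r (val m x) != k)].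
have [d] := ubnP #|cross m|; elim: d m => // d IHd m; rewrite ltnS => md mk.
case: (set_0Vmem (cross m)) => [c0|[c]].
  apply: (IHj k.+1 m); first by lia.
  move=> x; rewrite ltnS leq_eqVlt => /orP[/eqP xk|/mk //].
  apply/eqP/negPn/negP => e; have : x \in cross m by rewrite inE -xk eqxx.
  by rewrite c0 inE.
rewrite inE => /andP[/eqP rc rb]; set b := val m c in rb.
have mb : val m b = c by rewrite matchingK.
have kb : (k < r b)%N.
  rewrite ltn_neqAle eq_sym rb leqNgt /=; apply/negP => bk.
  by move: (mk b bk); rewrite mb => e; rewrite -e rc ltnn in bk.
have := congr1 (fun f : V => f m) (yraise k b kb).
rewrite sum_ffunE [RHS]ffunE.
rewrite (bigID (fun a => r (val m a) == k)) /=.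
have same a : (r a == k) && (r (val m a) == k) -> pact (tperm a b) y m = y m.
  move=> /andP[/eqP ra /eqP rma].
  have ac : a != c by apply/eqP => e; rewrite e -/b in rma; rewrite rma ltnn in kb.
  by rewrite pactE mact_tperm_swap // -pactE yrow // rc rma.
rewrite (eq_bigr _ same) sumr_const (bigD1 c) ?rc ?eqxx //= pactE mact_tperm_partner.
rewrite big1 ?addr0; last first.
  move=> a /andP[/andP[/eqP ra rma] ac]; rewrite pactE.
  set e := val m a in rma.
  have ke : (k < r e)%N.
    rewrite ltn_neqAle eq_sym rma leqNgt /=; apply/negP => ek.
    by move: (mk e ek); rewrite matchingK ra => e'; rewrite -e' ltnn in ek.
  have ab : a != b by apply/eqP => e'; rewrite -e' ra ltnn in kb.
  have bc : b != c by apply/eqP => e'; rewrite e' rc ltnn in kb.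
  set m' := mact _ _.
  have m'E x : val m' x = tperm a b (val m (tperm a b x)).
    by rewrite -[x in LHS](tpermK a b) mactE.
  have m'a : val m' a = c by rewrite m'E tpermL mb (@tpermD _ a b c).
  have m'c : val m' c = a by rewrite m'E (@tpermD _ a b c) // -/b tpermR.
  have m'D x : x != a -> x != b -> x != c -> x != e -> val m' x = val m x.
    move=> xa xb xc xe; rewrite m'E (@tpermD _ a b x) 1?eq_sym //.
    rewrite tpermD // eq_sym; first by apply: contra_neq xe => mx; rewrite /e -mx matchingK.
    by apply: contra_neq xc => mx; rewrite -mb -mx matchingK.
  apply: IHd.
    apply: leq_trans md; apply: proper_card; apply/properP; split; last first.
      by exists c; rewrite inE rc eqxx /= ?rb // m'c ra eqxx.
    apply/subsetP => x; rewrite !inE => /andP[/eqP rx].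
    case: (eqVneq x a) => [->|xa]; first by rewrite m'a rc eqxx.
    case: (eqVneq x c) => [->|xc]; first by rewrite m'c ra eqxx.
    rewrite rx eqxx m'D //.
      by apply/eqP => e'; rewrite -e' rx ltnn in kb.
    by apply/eqP => e'; rewrite -e' rx ltnn in ke.
  move=> x xk; rewrite m'D ?mk //; apply/eqP => e'; move: xk; rewrite e'.
  - by rewrite ra ltnn.
  - by rewrite ltnNge ltnW.
  - by rewrite rc ltnn.
  - by rewrite ltnNge ltnW.
(* The surviving terms are [n] copies of [y m] from vertices matched inside row [k] and one from
   [c], against [- y m]: so [n + 2] copies of [y m] vanish. *)
set n := #|_| => /eqP; rewrite -subr_eq0 opprK -mulrSr -mulrSr mulrn_eq0 /=.
by move/eqP.
Qed.

End MatchingModule.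

(** * Tableaux and Specht modules *)

Lemma cell_index mu k : (k < sumn mu)%N ->
  (sumn (take (cell mu k).1 mu) + (cell mu k).2)%N = k.
Proof.
elim: mu k => [|a mu IH] k //= kmu; case: (ltnP k a) => ka //=.
by rewrite -addnA IH; lia.
Qed.

Lemma cell_bound mu k : (k < sumn mu)%N ->
  ((cell mu k).2 < nth 0 mu (cell mu k).1)%N.
Proof.
elim: mu k => [|a mu IH] k //= kmu; case: (ltnP k a) => ka //=.
by apply: IH; lia.
Qed.

Lemma cell_onto mu i c : (c < nth 0 mu i)%N ->
  (sumn (take i mu) + c < sumn mu)%N /\ cell mu (sumn (take i mu) + c) = (i, c).
Proof.
elim: mu i => [|a mu IH] [|i] //= ci; first by rewrite ci; split => //; lia.
have [lt eq] := IH i ci; rewrite -addnA; split; first by lia.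
by rewrite ltnNge leq_addr /= addKn eq.
Qed.

Section Cells.

Context (N : nat) (mu : seq nat) (muN : sumn mu = N).

Let lt_mu (k : 'I_N) : (k < sumn mu)%N.
Proof. by rewrite muN. Qed.

Lemma cell_inj : injective (fun k : 'I_N => ((cell mu k).1, (cell mu k).2)).
Proof.
move=> k l /= [e1 e2]; apply: val_inj => /=.
by rewrite -(cell_index (lt_mu k)) e1 e2 cell_index.
Qed.

Lemma cell_surj i c : (c < nth 0 mu i)%N ->
  exists k : 'I_N, (cell mu k).1 = i /\ (cell mu k).2 = c.
Proof.
move=> /cell_onto[]; rewrite muN => lt eq.
by exists (Ordinal lt); rewrite /= eq.
Qed.

Lemma cell_left_justified (b : 'I_N) k : (k < (cell mu b).2)%N ->
  exists b' : 'I_N, (cell mu b').1 = (cell mu b).1 /\ (cell mu b').2 = k.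
Proof. by move=> kb; apply: cell_surj; apply: ltn_trans kb (cell_bound _). Qed.

Lemma card_cell_row i : #|[set k : 'I_N | (cell mu k).1 == i]| = nth 0 mu i.
Proof.
pose f (c : 'I_(nth 0 mu i)) : 'I_N :=
  cast_ord muN (Ordinal (cell_onto (ltn_ord c)).1).
have fE c : cell mu (f c) = (i, val c) by rewrite /= (cell_onto (ltn_ord c)).2.
rewrite -[RHS]card_ord -cardsT -(card_imset _ (f := f)); last first.
  by move=> c d e; apply: val_inj; have := fE d; rewrite -e (fE c) => -[].
apply: eq_card => k; rewrite inE; apply/eqP/imsetP => [ki|[c _ ->]].
  have kc : ((cell mu k).2 < nth 0 mu i)%N by rewrite -ki cell_bound.
  by exists (Ordinal kc) => //; apply: cell_inj;
     move: (fE (Ordinal kc)) => /= ->; rewrite /= ki.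
by rewrite fE.
Qed.

End Cells.

Lemma perm_of_card_fibers N (f g : 'I_N -> nat) :
    (forall i, #|[set x | f x == i]| = #|[set x | g x == i]|) ->
  exists p : {perm 'I_N}, forall x, f (p x) = g x.
Proof.
move=> fg; pose s := [tuple f x | x < N]; pose t := [tuple g x | x < N].
have cnt (h : 'I_N -> nat) i :
    count_mem i [tuple h x | x < N] = #|[set x | h x == i]|.
  rewrite count_map cardsE cardE /enum_mem size_filter -enumT.
  by rewrite (_ : ord_tuple N = enum (ordinal N) :> seq _) ?val_ord_tuple.
have : perm_eq t s by apply/allP => i _ /=; rewrite !cnt fg.
move=> /tuple_permP[p e]; exists p => x.
have := congr1 (fun u => nth 0%N u x) e.
by rewrite -!tnth_nth !tnth_mktuple.
Qed.

Section Specht.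

Context (R : realFieldType) (N : nat).
Local Notation M := (matching N).
Local Notation V := {ffun M -> R^o}.
Local Notation pact := (@pact R N).

Definition dot (f g : V) : R := \sum_m f m * g m.

Lemma dotC f g : dot f g = dot g f.
Proof. by apply: eq_bigr => m _; rewrite mulrC. Qed.

Lemma dot_sumr I (s : seq I) (Q : pred I) (F : I -> V) f :
  dot f (\sum_(i <- s | Q i) F i) = \sum_(i <- s | Q i) dot f (F i).
Proof.
rewrite exchange_big /=; apply: eq_bigr => m _.
by rewrite sum_ffunE mulr_sumr.
Qed.

Lemma dot_suml I (s : seq I) (Q : pred I) (F : I -> V) f :
  dot (\sum_(i <- s | Q i) F i) f = \sum_(i <- s | Q i) dot (F i) f.
Proof. by rewrite dotC dot_sumr; apply: eq_bigr => i _; rewrite dotC. Qed.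

Lemma dotZr c f g : dot f (c *: g) = c * dot f g.
Proof. by rewrite mulr_sumr; apply: eq_bigr => m _; rewrite ffunE mulrCA. Qed.

Lemma dotZl c f g : dot (c *: f) g = c * dot f g.
Proof. by rewrite dotC dotZr dotC. Qed.

Lemma dotDr f g h : dot f (g + h) = dot f g + dot f h.
Proof. by rewrite -big_split; apply: eq_bigr => m _; rewrite !ffunE mulrDr. Qed.

Lemma dotBr f g h : dot f (g - h) = dot f g - dot f h.
Proof. by rewrite -sumrB; apply: eq_bigr => m _; rewrite !ffunE mulrBr. Qed.

Lemma dotBl f g h : dot (g - h) f = dot g f - dot h f.
Proof. by rewrite dotC dotBr !(dotC f). Qed.

Lemma dot0r f : dot f 0 = 0.
Proof. by apply: big1 => m _; rewrite ffunE mulr0. Qed.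

Lemma dot_eq0 f : dot f f = 0 -> f = 0.
Proof.
move=> /eqP; rewrite psumr_eq0 => [/allP f0|m _]; last by rewrite -expr2 sqr_ge0.
apply/ffunP => m; rewrite ffunE; apply/eqP.
by have := f0 m (mem_index_enum _); rewrite mulf_eq0 orbb.
Qed.

Lemma dot_pact p f g : dot (pact p f) g = dot f (pact p^-1 g).
Proof.
rewrite /dot (reindex (mact p^-1)) /=; last first.
  by exists (mact p) => m _; rewrite ?mactK ?mactKV.
by apply: eq_bigr => m _; rewrite !pactE mactKV.
Qed.

Lemma pact_inj p : injective (pact p).
Proof. by apply: (can_inj (g := pact p^-1)) => y; rewrite pactM mulVg pact1. Qed.

Lemma highest_weight_pact (r : 'I_N -> nat) (p : {perm 'I_N}) y :
  highest_weight pact r y -> highest_weight pact (fun x => r (p x)) (pact p y).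
Proof.
have conj a b : pact (tperm a b) (pact p y) = pact p (pact (tperm (p a) (p b)) y).
  by rewrite !pactM -tpermJ conjgE mulgA mulgV mul1g.
move=> [yrow yraise]; split => [a b ab|i b ib]; first by rewrite conj yrow.
under eq_bigr do rewrite conj.
rewrite -linear_sum -linearN /= -(yraise i (p b) ib); congr (pact p _).
by rewrite [RHS](reindex_inj (@perm_inj _ p)).
Qed.

(** Induction on the number of moved points: composing [p] with the transposition of [x] and [p x]
    makes [x] fixed and moves no new point. *)
Lemma pact_row_fixed (r : 'I_N -> nat) (y : V) :
    (forall a b, r a = r b -> pact (tperm a b) y = y) ->
  forall p : {perm 'I_N}, (forall x, r (p x) = r x) -> pact p y = y.
Proof.
move=> yrow p; have [d] := ubnP #|[set x | p x != x]|.
elim: d p => // d IHd p; rewrite ltnS => pd rp.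
case: (set_0Vmem [set x | p x != x]) => [p0|[x]].
  suff -> : p = 1%g by rewrite pact1.
  apply/permP => x; rewrite perm1; apply/eqP/negPn/negP => px.
  have : x \in [set x | p x != x] by rewrite inE.
  by rewrite p0 inE.
rewrite inE => px; pose q := (p * tperm x (p x))%g.
have -> : p = (q * tperm x (p x))%g by rewrite -mulgA tperm2 mulg1.
rewrite -pactM yrow ?rp //; apply: IHd => [|z]; last first.
  by rewrite permM -[RHS]rp; case: tpermP => [->|->|//]; rewrite rp.
apply: leq_trans pd; apply: proper_card; apply/properP; split; last first.
  by exists x; rewrite !inE // permM tpermR eqxx.
apply/subsetP => z; rewrite !inE permM; apply: contraNneq => pz.
rewrite pz tpermD //; first by apply: contraNneq px => ->; rewrite pz.
by apply: contraNneq px => e; rewrite -(inj_eq (@perm_inj _ p)) e pz.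
Qed.

(** * Row and column sums of a tableau *)

Section Tableau.

Context (mu : seq nat).

Definition cell_col (x : 'I_N) := (cell mu x).2.

Definition row_sum (y : V) : V := \sum_(p | rowstab mu p) pact p y.

Definition col_sum (y : V) : V := antisym pact cell_col setT y.

Lemma rowstabV (p : {perm 'I_N}) : rowstab mu p^-1 = rowstab mu p.
Proof.
have aux (q : {perm 'I_N}) : rowstab mu q -> rowstab mu q^-1.
  move=> /forallP H; apply/forallP => x.
  by have := H (q^-1 x)%g; rewrite permKV eq_sym.
by apply/idP/idP => /aux; rewrite ?invgK.
Qed.

Lemma colstabV (p : {perm 'I_N}) : colstab mu p^-1 = colstab mu p.
Proof.
have aux (q : {perm 'I_N}) : colstab mu q -> colstab mu q^-1.
  move=> /forallP H; apply/forallP => x.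
  by have := H (q^-1 x)%g; rewrite permKV eq_sym.
by apply/idP/idP => /aux; rewrite ?invgK.
Qed.

Lemma col_group_colstab : col_group cell_col setT =1 colstab mu.
Proof. by move=> q; rewrite /col_group /perm_on; case: subsetP => // -[] x; rewrite inE. Qed.

Lemma fact_pact g (f : V) : fact g f = pact g^-1 f.
Proof. by apply/ffunP => m; rewrite !ffunE. Qed.

Lemma scalefE (c : R) (f : V) : scalef c f = c *: f.
Proof. by apply/ffunP => m; rewrite !ffunE. Qed.

Lemma col_sumE (y : V) :
  col_sum y = \sum_(q | colstab mu q) (-1) ^+ odd_perm q *: pact q y.
Proof. by apply: eq_bigl => q; rewrite col_group_colstab. Qed.

Lemma ystE (f : V) : yst mu f = row_sum (col_sum f).
Proof.
rewrite /row_sum (reindex_inj invg_inj) /yst /=.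
apply: eq_big => [p|p _]; first by rewrite rowstabV.
rewrite fact_pact; congr (pact _ _); rewrite col_sumE (reindex_inj invg_inj) /=.
apply: eq_big => [q|q _]; first by rewrite colstabV.
by rewrite scalefE fact_pact odd_permV invgK.
Qed.

Lemma dot_row_sum f g : dot (row_sum f) g = dot f (row_sum g).
Proof.
rewrite dot_suml dot_sumr (reindex_inj invg_inj) /=.
by apply: eq_big => [p|p _]; rewrite ?rowstabV // dot_pact invgK.
Qed.

Lemma dot_col_sum f g : dot (col_sum f) g = dot f (col_sum g).
Proof.
rewrite !col_sumE dot_suml dot_sumr (reindex_inj invg_inj) /=.
apply: eq_big => [p|p _]; rewrite ?colstabV //.
by rewrite dotZl dotZr dot_pact invgK odd_permV.
Qed.

Lemma row_sum0 : row_sum 0 = 0.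
Proof. by apply: big1 => p _; rewrite linear0. Qed.

Lemma col_sum0 : col_sum 0 = 0.
Proof. by rewrite col_sumE; apply: big1 => p _; rewrite linear0 scaler0. Qed.

Lemma in_specht_yst g (f : V) : in_specht mu (pact g (yst mu f)).
Proof.
exists (fun h => if h == g^-1%g then f else 0).
rewrite (bigD1 g^-1%g) //= eqxx big1 ?addr0 => [|h hg]; first by rewrite fact_pact invgK.
by rewrite (negbTE hg) fact_pact ystE col_sum0 row_sum0 linear0.
Qed.

(** With [w = col_sum (row_sum (pact g z))], self-adjointness of both sums turns [dot w w] into the
    product of [z] with a translate of [yst mu w], an element of the Specht module. *)
Lemma orth_specht_col_row_sum (z : V) :
    (forall u : V, in_specht mu u -> dot z u = 0) ->
  forall g, col_sum (row_sum (pact g z)) = 0.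
Proof.
move=> orth g; apply: dot_eq0; rewrite dot_col_sum dot_row_sum dot_pact -ystE.
exact/orth/in_specht_yst.
Qed.

End Tableau.

End Specht.

(** * Vectors fixed by a Young subgroup *)

(** The vertices of [A] smaller than their partner are exchanged by [m] with the remaining ones. *)
Lemma card_internal_even (N : nat) (m : matching N) (A : {set 'I_N}) :
  (forall x, (val m x \in A) = (x \in A)) -> ~~ odd #|A|.
Proof.
move=> mA; pose B := [set x in A | (x < val m x)%N].
suff -> : #|A| = #|B|.*2 by rewrite odd_double.
rewrite -addnn -{1}(card_imset B (@perm_inj _ (val m))) addnC.
rewrite -(cardsID B A) (setIidPr _); last by apply/subsetP => x; rewrite inE => /andP[].
congr (_ + _)%N; apply: eq_card => x; rewrite !inE.
have lt_or y : (val m y < y)%N || (y < val m y)%N.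
  by rewrite -neq_ltn; exact: matching_neq.
apply/andP/imsetP => [[nB xA]|[y]].
  exists (val m x); last by rewrite matchingK.
  rewrite inE mA xA matchingK /=; move: nB; rewrite xA /=.
  by have /orP[-> //|->] := lt_or x.
rewrite inE => /andP[yA ym] ->; rewrite mA yA matchingK /=; split => //.
by rewrite -leqNgt ltnW.
Qed.

Lemma even_row_sizes_partition (n : nat) (r : 'I_(2 * n) -> nat) :
    (forall i j, (i <= j)%N ->
       (#|[set x | r x == j]| <= #|[set x | r x == i]|)%N) ->
    (forall i, ~~ odd #|[set x | r x == i]|) ->
  exists lam, [/\ is_partition n lam, sumn (dbl_part lam) = (2 * n)%N &
    forall i, nth 0%N (dbl_part lam) i = #|[set x | r x == i]|].
Proof.
set s := fun i => #|[set x | r x == i]| => s_noninc s_even.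
have exL : exists L, s L == 0%N.
  exists (\max_x r x).+1; rewrite cards_eq0; apply/eqP/setP => x.
  by rewrite !inE ltn_eqF // ltnS leq_bigmax.
(* [L] is the first empty row; by monotonicity all later rows are empty, so the halved sizes before
   [L] are the positive parts sought. *)
case: (ex_minnP exL) => L /eqP sL Lmin.
have s_pos i : (i < L)%N -> (0 < s i)%N.
  by move=> iL; rewrite lt0n; apply/negP => /Lmin; rewrite leqNgt iL.
have s_zero i : (L <= i)%N -> s i = 0%N.
  by move=> /s_noninc; rewrite -/(s L) -/(s i) sL leqn0 => /eqP.
have rL x : (r x < L)%N.
  rewrite ltnNge; apply/negP => /s_zero /eqP; rewrite cards_eq0 => /eqP/setP/(_ x).
  by rewrite !inE eqxx.
have dblE : dbl_part (mkseq (fun i => (s i)./2) L) = mkseq s L.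
  rewrite /dbl_part -map_comp; apply: eq_map => i /=.
  by rewrite mul2n even_halfK //; apply: s_even.
have sumE : sumn (mkseq s L) = (2 * n)%N.
  rewrite sumnE big_map -{1}(subn0 L) -/(index_iota 0 L) big_mkord.
  rewrite -[RHS]card_ord -sum1_card (partition_big (fun x => Ordinal (rL x)) predT) //=.
  apply: eq_bigr => i _; rewrite /s -sum1_card; apply: eq_bigl => x.
  by rewrite inE.
exists (mkseq (fun i => (s i)./2) L); split; last 1 first.
- move=> i; rewrite dblE; case: (ltnP i L) => iL; first by rewrite nth_mkseq.
  by rewrite nth_default ?size_mkseq // -/(s i) s_zero.
- rewrite /is_partition; apply/and3P; split.
  + apply/(sortedP 0%N) => i; rewrite size_mkseq => iL.
    rewrite !nth_mkseq //; last by apply: ltnW.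
    by apply: half_leq; apply: s_noninc.
  + apply/allP => a /mapP[i]; rewrite mem_iota => /andP[_ iL] ->.
    by have := s_pos i iL; have := s_even i; rewrite -/(s i); lia.
  + rewrite -(eqn_pmul2l (isT : (0 < 2)%N)) -sumE -dblE.
    by rewrite /dbl_part !sumnE !big_map big_distrr.
- by rewrite dblE.
Qed.

(** * Vanishing criterion for vectors fixed by a Young subgroup *)

Section Key.

Context (R : realFieldType).
Local Notation pact := (@pact R _).

(** The identity and the [tperm x b] represent the cosets of the symmetric group of row [i] in that
    of row [i] enlarged by [b], so [z'] is symmetric in the enlarged row. *)
Lemma raised_row_fixed (N : nat) (r : 'I_N -> nat)
    (z : {ffun matching N -> R^o}) (i : nat) (b : 'I_N) :
    (forall a a', r a = r a' -> pact (tperm a a') z = z) -> (i < r b)%N ->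
    let r' x := if x == b then i else r x in
    let z' := z + \sum_(x | r x == i) pact (tperm x b) z in
  forall a a', r' a = r' a' -> pact (tperm a a') z' = z'.
Proof.
move=> zrow ib r' z'.
have tb a : r a = i -> pact (tperm b a) z' = z'.
  move=> ra; have ab : a != b by apply/eqP => e; rewrite -e ra ltnn in ib.
  rewrite /z' linearD linear_sum /= (bigD1 a) ?ra ?eqxx //= [in RHS](bigD1 a) ?ra ?eqxx //=.
  rewrite tpermC pactM tperm2 pact1 addrCA; congr (_ + (_ + _)).
  apply: eq_bigr => x /andP[/eqP rx xa].
  rewrite pactM conjgC tpermJ tpermR tpermD //; last by rewrite eq_sym.
  by rewrite -pactM zrow // rx ra.
move=> a a'; rewrite /r'.
case: (eqVneq a b) => [->|ab]; case: (eqVneq a' b) => [->|a'b] //.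
- by rewrite tperm1 pact1.
- by move=> e; apply: tb.
- by move=> e; rewrite tpermC; apply: tb.
move=> raa'; rewrite /z' linearD linear_sum /= zrow //; congr (_ + _).
have rt x : r (tperm a a' x) = r x by case: tpermP => [->|->|].
rewrite [RHS](reindex_inj (@perm_inj _ (tperm a a'))) /=.
apply: eq_big => [x|x _]; first by rewrite rt.
rewrite pactM -[in RHS](zrow a a') // pactM; congr (pact _ z).
by rewrite [LHS]conjgCV tpermV tpermJ (@tpermD _ a a' b) // eq_sym.
Qed.

(** Induction on the sum of the row labels. Moving a point to an earlier row, or exchanging the
    labels of two rows whose sizes increase, lowers this sum and does not shrink row 0. The first
    move shows that [z] is a highest weight vector, the second that the row sizes may be taken
    nonincreasing. *)
Theorem row_fixed_eq0 (n k : nat) (r : 'I_(2 * n) -> nat)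
    (z : {ffun matching (2 * n) -> R^o}) :
    (forall a b, r a = r b -> pact (tperm a b) z = z) ->
    (k <= #|[set x | r x == 0%N]|)%N ->
    (forall lam, is_partition n lam -> (k <= 2 * head 0%N lam)%N ->
       forall g, col_sum (dbl_part lam) (row_sum (dbl_part lam) (pact g z)) = 0) ->
  z = 0.
Proof.
have [d] := ubnP (\sum_x r x)%N; elim: d r z => // d IHd r z.
rewrite ltnS => rd zrow kr kill.
have raise i b : (i < r b)%N -> \sum_(a | r a == i) pact (tperm a b) z = - z.
  move=> ib; apply/eqP; rewrite -addr_eq0 addrC; apply/eqP.
  apply: (IHd (fun x => if x == b then i else r x)).
  - apply: leq_trans rd; rewrite (bigD1 b) //= eqxx [X in (_ < X)%N](bigD1 b) //=.
    rewrite -addSn; apply: leq_add => //; apply: leq_sum => x /negbTE ->.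
    exact: leqnn.
  - exact: raised_row_fixed.
  - apply: (leq_trans kr); apply: subset_leq_card; apply/subsetP => x.
    rewrite !inE; case: (eqVneq x b) => [->|//] /eqP e; by rewrite e in ib.
  - move=> lam lamn klam g; rewrite linearD linear_sum /=.
    have killD y y' : row_sum (dbl_part lam) (y + y') =
        row_sum (dbl_part lam) y + row_sum (dbl_part lam) y'.
      by rewrite -big_split; apply: eq_bigr => p _; rewrite linearD.
    have kill_sum : row_sum (dbl_part lam)
        (\sum_(a | r a == i) pact g (pact (tperm a b) z)) =
        \sum_(a | r a == i) row_sum (dbl_part lam) (pact (g * tperm a b)%g z).
      rewrite exchange_big; apply: eq_bigr => p _; rewrite linear_sum /=.
      by apply: eq_bigr => a _; rewrite [X in pact _ X]pactM.
    rewrite killD kill_sum /col_sum antisymD [X in _ + X]antisym_sum.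
    rewrite [X in _ + X]big1 => [|a _]; last exact: (kill lam lamn klam).
    by rewrite addr0; exact: (kill lam lamn klam).
have hz : highest_weight pact r z by split.
pose s i := #|[set x | r x == i]|.
have swap i j : (i < j)%N -> (s i < s j)%N -> z = 0.
  move=> ij sij.
  pose r' x := if r x == i then j else if r x == j then i else r x.
  have r'i x : (r' x == i) = (r x == j).
    rewrite /r'; case: (eqVneq (r x) i) => [->|xi].
      by rewrite eq_sym.
    by case: (eqVneq (r x) j) => [_|_]; rewrite ?eqxx // (negbTE xi).
  apply: (IHd r') kill.
  - apply: leq_trans rd.
    (* Stated without subtraction between the sums: exchanging the labels lowers their sum by
       [(j - i) * (s j - s i)]. *)
    have : (\sum_x (r' x + (r x == j) * (j - i)) =
            \sum_x (r x + (r x == i) * (j - i)))%N.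
      apply: eq_bigr => x _; rewrite /r'.
      case: (eqVneq (r x) i) => [->|xi]; first by rewrite ltn_eqF //; lia.
      by case: (eqVneq (r x) j) => [->|_]; lia.
    rewrite !big_split -!big_distrl /=.
    have sE l : (\sum_x (r x == l) = s l)%N.
      by rewrite -big_mkcond sum1_card /s cardsE.
    rewrite !sE; nia.
  - move=> a b; rewrite /r' => e; apply: zrow; move: e.
    by case: (eqVneq (r a) i) => ?; case: (eqVneq (r a) j) => ?;
       case: (eqVneq (r b) i) => ?; case: (eqVneq (r b) j) => ?; lia.
  - case: (posnP i) => i0; last first.
      apply: (leq_trans kr); apply/eq_leq/eq_card => x; rewrite !inE /r'.
      case: (eqVneq (r x) i) => [->|_]; first by lia.
      by case: (eqVneq (r x) j) => [->|_]; lia.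
    have -> : #|[set x | r' x == 0%N]| = s j.
      by apply: eq_card => x; rewrite !inE -r'i i0.
    by apply: (leq_trans kr); have := ltnW sij; rewrite {1}/s i0.
(* If no matching stays inside the rows, the highest weight vector vanishes; otherwise such a
   matching forces even row sizes. *)
case: (boolP [exists m : matching (2 * n), [forall x, r (val m x) == r x]]); last first.
  rewrite negb_exists => /forallP no_int.
  apply: (highest_weight_matching_eq0 hz) => m mr.
  by have /negP[] := no_int m; apply/forallP => x; apply/eqP.
move=> /existsP[m /forallP mr].
case: (boolP [exists i : 'I_(\max_x r x).+1, [exists j : 'I_(\max_x r x).+1,
         (i < j) && (s i < s j)]]%N) => [|nosw].
  by move=> /existsP[i /existsP[j /andP[ij sij]]]; apply: (swap i j).
have s_noninc i j : (i <= j)%N -> (s j <= s i)%N.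
  rewrite leq_eqVlt => /orP[/eqP -> //|ij]; rewrite leqNgt; apply/negP => sij.
  have jK : (j < (\max_x r x).+1)%N.
    have : (0 < s j)%N by apply: leq_ltn_trans sij.
    rewrite card_gt0 => /set0Pn[x]; rewrite inE => /eqP <-.
    by rewrite ltnS leq_bigmax.
  move/negP: nosw; apply; apply/existsP; exists (Ordinal (ltn_trans ij jK)).
  by apply/existsP; exists (Ordinal jK); rewrite /= ij sij.
have s_even i : ~~ odd (s i).
  by apply: (@card_internal_even _ m) => x; rewrite !inE (eqP (mr x)).
have [lam [lamn sumlam nthlam]] := even_row_sizes_partition s_noninc s_even.
pose mu := dbl_part lam; pose row (x : 'I_(2 * n)) := (cell mu x).1.
(* The rows of [r] have the sizes of the shape [mu], so a relabelling carries them to the rows of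
   the standard filling. *)
have [p pE] : exists p : {perm 'I_(2 * n)}, forall x, r (p x) = row x.
  by apply: perm_of_card_fibers => i; rewrite (card_cell_row sumlam) nthlam.
have hy : highest_weight pact row (pact p z).
  by apply: eq_highest_weight (highest_weight_pact p hz) => x; rewrite pE.
suff : pact p z = 0 by move=> e; apply: (@pact_inj _ _ p); rewrite e linear0.
apply: (highest_weight_antisym_eq0 (@pact1 R _) (@pactM R _) hy
          (cell_inj sumlam) (cell_left_justified sumlam)).
have klam : (k <= 2 * head 0%N lam)%N.
  apply: (leq_trans kr); rewrite -nthlam /dbl_part.
  by case: (lam) => //= *; lia.
have := kill lam lamn klam p.
(* The vector is row-fixed, so the row sum only multiplies it by the order of the row stabilizer. *)
have -> : row_sum mu (pact p z) = \sum_(q : {perm 'I_(2 * n)} | rowstab mu q) pact p z.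
  apply: eq_bigr => q /forallP q_row; apply: (pact_row_fixed (r := row)).
    by case: hy.
  by move=> x; apply/eqP/q_row.
rewrite /col_sum antisym_sum sumr_const => /eqP.
rewrite -scaler_nat scaler_eq0 pnatr_eq0 => /orP[/eqP/card0_eq/(_ 1%g)|/eqP //].
by rewrite inE => /forallP[] x; rewrite perm1.
Qed.

End Key.

(** * Fat partitions and cycle types *)

Section RevLex.

Lemma revlex_gt_irr lam : revlex_gt lam lam = false.
Proof. by elim: lam => //= a lam ->; rewrite ltnn eqxx. Qed.

Lemma revlex_gt_trans : transitive revlex_gt.
Proof.
move=> mu lam nu; elim: lam mu nu => [|a lam IH] [|b mu] [|c nu] //=.
  by move=> + b0 => /orP[ba|/andP[/eqP -> _]] //; apply: ltn_trans ba.
move=> /orP[ba|/andP[/eqP -> lm]] /orP[cb|/andP[/eqP <- mn]].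
- by rewrite (ltn_trans cb ba).
- by rewrite ba.
- by rewrite cb.
- by rewrite eqxx (IH _ _ lm mn) orbT.
Qed.

Lemma count1_sumn l : all (fun a => 0 < a)%N l ->
  (count_mem 1%N l <= sumn l)%N /\
  (count_mem 1%N l = sumn l -> l = nseq (sumn l) 1%N).
Proof.
elim: l => //= a l IH /andP[a0 /IH[le eq]]; split; first by case: eqP; lia.
case: eqP => [->|]; last by lia.
by rewrite add1n add1n => -[/eq {1}->].
Qed.

(** If the first part is exactly [n - t], the others sum to [t], and the first of them exceeding 1,
    if any, puts [lam] above the hook. *)
Lemma fat_partition n t lam : (t < n)%N -> is_partition n lam ->
    (n - t <= head 0%N lam)%N ->
  revlex_gt lam (hook n t) \/ lam = hook n t.
Proof.
move=> tn /and3P[_ + /eqP]; case: lam => [|a l] /=; first by lia.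
move=> /andP[_ l_pos] sum_l.
rewrite leq_eqVlt => /orP[/eqP ea|->]; last by left.
rewrite -ea ltnn eqxx /= /hook.
have : sumn l = t by lia.
elim: l l_pos t {tn sum_l ea} => [|b l IH] /=; first by move=> _ t <-; right.
move=> /andP[b0 l_pos] [|t]; first by lia.
rewrite /= => sum_l; case: (ltngtP 1%N b) b0 => //= [_|eb] _; first by left.
have st : sumn l = t by lia.
by case: (IH l_pos t st) => [->|[->]]; [left | right; rewrite eb].
Qed.

(** The first part is at least [n - t > 1] and the others sum to at most [t]; with [t] ones among
    them, [rho] would be the hook itself. *)
Lemma count1_above_hook n t rho : (0 < t)%N -> (2 * t < n)%N ->
    is_partition n rho -> revlex_gt rho (hook n t) ->
  (count_mem 1%N rho < t)%N.
Proof.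
move=> t0 tn /and3P[_]; case: rho => [|a l] //= /andP[_ l_pos] /eqP suml.
have [le eq] := count1_sumn l_pos.
move=> /orP[ta|/andP[/eqP ea gt]].
  have -> : (a == 1%N) = false by lia.
  by rewrite add0n; apply: (leq_ltn_trans le); lia.
have -> : (a == 1%N) = false by lia.
have st : sumn l = t by lia.
rewrite add0n ltn_neqAle; apply/andP; split; last by rewrite -st.
apply/eqP => ct; move: gt; rewrite eq ?st //.
by rewrite revlex_gt_irr.
Qed.

Lemma hook_is_partition n t : (t < n)%N -> is_partition n (hook n t).
Proof.
move=> tn; rewrite /is_partition /hook; apply/and3P; split.
- rewrite /= path_min_sorted; last by apply/allP => x /nseqP[-> _]; rewrite /=; lia.
  by elim: t {tn} => //= -[|t].
- by rewrite /= subn_gt0 tn; apply/allP => x /nseqP[->].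
- by rewrite /= sumn_nseq mul1n subnK // ltnW.
Qed.

(** This locates the trivial module: a partition with a second part has a first part below [n], so
    [[:: n]] comes first in the sorted list, and only there since the list has no repetition. *)
Lemma head_above_hook n t (ps : seq (seq nat)) : (0 < t < n)%N ->
    sorted revlex_gt ps ->
    (forall lam, (lam \in ps) = is_partition n lam && revlex_gt lam (hook n t)) ->
  forall i, (i < size ps)%N -> (nth [::] ps i == [:: n]) = (i == 0%N).
Proof.
move=> /andP[t0 tn] srt mem_ps.
have n_ps : [:: n] \in ps.
  rewrite mem_ps /hook /= ltn_subrL t0 (leq_trans _ tn) //= andbT /is_partition /=.
  by rewrite addn0 eqxx (leq_trans _ tn).
have uniq_ps : uniq ps by apply: (sorted_uniq revlex_gt_trans revlex_gt_irr).
have ps0 : nth [::] ps 0 = [:: n].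
  move: srt; have : (0 < size ps)%N by case: (ps) n_ps.
  have : nth [::] ps 0 \in ps by apply: mem_nth; case: (ps) n_ps.
  case: (ps) mem_ps n_ps => //= lam ps' mem_ps n_ps lam_ps _ srt.
  move: n_ps; rewrite inE => /orP[/eqP //|n_ps].
  have /allP/(_ _ n_ps) := order_path_min revlex_gt_trans srt.
  move: lam_ps; rewrite mem_ps => /andP[/and3P[_]].
  case: (lam) => //= a [|b l] /= => [_ /eqP <- _|]; first by rewrite addn0 ltnn eqxx.
  by move=> /and3P[a0 b0 _] /eqP <-; lia.
move=> i ips; rewrite -ps0 nth_uniq //; by case: (ps) n_ps.
Qed.

End RevLex.

(** * Cycle types: symmetry, relabelling and common edges *)

Section CycleType.

Context (N : nat).
Local Notation M := (matching N).
Local Notation half_card := (fun C : {set 'I_N} => (#|C| %/ 2)%N).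

Definition union_rel (m m' : M) := [rel i j : 'I_N | (val m i == j) || (val m' i == j)].

Definition component (m m' : M) i := [set j | connect (union_rel m m') i j].

Definition components (m m' : M) : {set {set 'I_N}} :=
  [set component m m' i | i : 'I_N].

Lemma cycle_typeE (m m' : M) : cycle_type m m' =
  sort geq [seq half_card C | C <- enum (components m m')].
Proof. by []. Qed.

Lemma cycle_typeC (m m' : M) : cycle_type m m' = cycle_type m' m.
Proof.
rewrite !cycle_typeE; suff -> : components m m' = components m' m by [].
apply: eq_imset => i; apply/setP => j; rewrite !inE.
by apply: eq_connect => x y /=; rewrite orbC.
Qed.

Lemma component_mact (g : {perm 'I_N}) (m m' : M) i :
  component (mact g m) (mact g m') (g i) = g @: component m m' i.
Proof.
have e x y : union_rel (mact g m) (mact g m') (g x) (g y) = union_rel m m' x y.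
  by rewrite /union_rel /= -!/(val (mact g _)) !mactE !(inj_eq perm_inj).
have sub (u u' : M) (h : {perm 'I_N}) x y :
    (forall x y, union_rel u u' x y ->
       union_rel (mact h u) (mact h u') (h x) (h y)) ->
    connect (union_rel u u') x y ->
    connect (union_rel (mact h u) (mact h u')) (h x) (h y).
  move=> hom /connectP[p pth ->]; apply/connectP; exists (map h p).
    elim: p x pth => //= z p IH x /andP[xz zp].
    by apply/andP; split; [exact: hom | exact: IH].
  by rewrite last_map.
apply/setP => j; rewrite inE; apply/idP/imsetP => [gij|[k + ->]].
  exists (g^-1%g j); last by rewrite permKV.
  rewrite inE -{1}(permK g i) -(mactK g m) -(mactK g m').
  apply: sub gij => x y; rewrite !mactK -{1}(permKV g x) -{1}(permKV g y).
  by rewrite e.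
by rewrite inE; apply: sub => x y; rewrite e.
Qed.

Lemma cycle_type_mact (g : {perm 'I_N}) (m m' : M) :
  cycle_type (mact g m) (mact g m') = cycle_type m m'.
Proof.
rewrite !cycle_typeE; apply/perm_sortP.
- by move=> a b; apply: leq_total.
- by move=> a b c ab bc; apply: leq_trans bc ab.
- by move=> a b; rewrite andbC => /anti_leq.
have -> : components (mact g m) (mact g m') =
    [set g @: (C : {set 'I_N}) | C in components m m'].
  apply/setP => C; apply/imsetP/imsetP => [[i _ ->]|[_ /imsetP[i _ ->] ->]].
    exists (component m m' (g^-1%g i)); first exact: imset_f.
    by rewrite -component_mact permKV.
  by exists (g i) => //; rewrite component_mact.
have g_inj : injective (fun C : {set 'I_N} => g @: C).
  by apply: imset_inj; apply: perm_inj.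
have -> : [seq half_card C | C <- enum (components m m')] =
    [seq half_card C | C <- [seq g @: (C : {set 'I_N}) | C <- enum (components m m')]].
  rewrite -map_comp; apply: eq_map => C /=; rewrite card_imset //.
  exact: perm_inj.
apply: perm_map; apply: uniq_perm.
- exact: enum_uniq.
- by rewrite map_inj_uniq ?enum_uniq.
move=> C; rewrite mem_enum; apply/imsetP/mapP => [[D DC ->]|[D DC ->]].
  by exists D => //; rewrite mem_enum.
by exists D => //; rewrite -mem_enum.
Qed.

Lemma component_common_edge (m m' : M) x :
  val m x = val m' x -> component m m' x = [set x; val m x].
Proof.
move=> mm'; apply/setP => j; rewrite !inE; apply/idP/orP.
  move=> /connectP[p + ->]; suff H z : z \in [set x; val m x] ->
      path (union_rel m m') z p -> last z p \in [set x; val m x].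
    by move=> /H; rewrite !inE eqxx => /(_ isT) /orP.
  elim: p z => //= w p IH z zx /andP[zw]; apply: IH; move: zx zw.
  rewrite !inE => /orP[/eqP ->|/eqP ->]; first by rewrite -mm' orbb eq_sym => ->; rewrite orbT.
  by rewrite {2}mm' !matchingK orbb eq_sym => ->.
move=> [/eqP ->|/eqP ->]; first exact: connect0.
by apply: connect1; rewrite /= eqxx.
Qed.

(** [A] meets each common edge in at most one vertex, so its points lie in distinct components of
    size two, each contributing a part 1. *)
Lemma count1_cycle_type (m m' : M) (A : {set 'I_N}) :
    (forall x, x \in A -> val m x = val m' x) ->
    (forall x y, x \in A -> y \in A -> val m x != y) ->
  (#|A| <= count_mem 1%N (cycle_type m m'))%N.
Proof.
move=> mA indep; rewrite cycle_typeE.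
have /seq.permP -> : perm_eq (sort geq [seq half_card C | C <- enum (components m m')])
   [seq half_card C | C <- enum (components m m')].
  by rewrite perm_sort.
rewrite count_map -size_filter -(card_in_imset (f := component m m') (D := A)).
  rewrite cardE; apply: uniq_leq_size; first exact: enum_uniq.
  move=> C; rewrite mem_enum mem_filter /= => /imsetP[x xA ->].
  rewrite mem_enum imset_f // andbT component_common_edge ?mA //.
  by rewrite cards2 [x == _]eq_sym matching_neq.
move=> x y xA yA; rewrite !component_common_edge ?mA // => /setP/(_ y).
rewrite !inE eqxx /= -(mA x xA) => /orP[/eqP //|/eqP e].
by have := indep x y xA yA; rewrite -e eqxx.
Qed.

End CycleType.

(** * Self-adjoint equivariant operators *)

Section Operators.

Context (R : realFieldType) (N : nat).
Local Notation M := (matching N).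
Local Notation V := {ffun M -> R^o}.
Local Notation pact := (@pact R N).

(** Self-adjointness for the nondegenerate form [dot] already makes [B] linear. *)
Definition sym_equivariant (B : V -> V) : Prop :=
  (forall f g, dot (B f) g = dot f (B g)) /\
  (forall p f, pact p (B f) = B (pact p f)).

Lemma assoc_op_sym_equivariant rho : sym_equivariant (@assoc_op R N rho).
Proof.
split=> [f g|p f].
  rewrite /dot; under eq_bigr do rewrite ffunE mulr_suml.
  under [RHS]eq_bigr do rewrite ffunE mulr_sumr.
  rewrite (exchange_big_dep predT) //=; apply: eq_bigr => m _.
  by apply: eq_bigl => m'; rewrite cycle_typeC.
apply/ffunP => m; rewrite pactE !ffunE (reindex (mact p)) /=; last first.
  by exists (mact p^-1) => m' _; rewrite ?mactK ?mactKV.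
apply: eq_big => [m'|m' _]; first by rewrite cycle_type_mact.
by rewrite ffunE.
Qed.

(** Up to the order of the symmetric group, the orthogonal projection onto the invariant vectors. *)
Definition orbit_sum (f : V) : V := \sum_(p : {perm 'I_N}) pact p f.

Lemma orbit_sum_pact p f : orbit_sum (pact p f) = orbit_sum f.
Proof.
rewrite /orbit_sum [RHS](reindex_inj (mulIg p)) /=.
by apply: eq_bigr => q _; rewrite pactM.
Qed.

Lemma pact_orbit_sum p f : pact p (orbit_sum f) = orbit_sum f.
Proof.
rewrite /orbit_sum linear_sum /= [RHS](reindex_inj (mulgI p)) /=.
by apply: eq_bigr => q _; rewrite pactM.
Qed.

Lemma orbit_sum_sum I (s : seq I) (Q : pred I) (F : I -> V) :
  orbit_sum (\sum_(i <- s | Q i) F i) = \sum_(i <- s | Q i) orbit_sum (F i).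
Proof.
by rewrite exchange_big; apply: eq_bigr => p _; rewrite linear_sum.
Qed.

Lemma orbit_sumZ c f : orbit_sum (c *: f) = c *: orbit_sum f.
Proof. by rewrite scaler_sumr; apply: eq_bigr => p _; rewrite linearZ. Qed.

Lemma orbit_sum_sym_equivariant : sym_equivariant orbit_sum.
Proof.
split=> [f g|p f]; last by rewrite pact_orbit_sum orbit_sum_pact.
rewrite dot_suml dot_sumr (reindex_inj invg_inj).
by apply: eq_bigr => p _; rewrite dot_pact invgK.
Qed.

(** The orbit sum absorbs every permutation, so only a signed count over the column stabilizer is
    left; the first two cells [a], [b] of column 0 make it vanish. *)
Lemma orbit_sum_specht_eq0 (mu : seq nat) (u : V) :
    sumn mu = N -> (0 < nth 0 mu 0)%N -> (0 < nth 0 mu 1)%N ->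
  in_specht mu u -> orbit_sum u = 0.
Proof.
move=> muN mu0 mu1 [f ->]; rewrite orbit_sum_sum big1 // => g _.
rewrite fact_pact orbit_sum_pact ystE orbit_sum_sum big1 // => p _.
rewrite orbit_sum_pact col_sumE orbit_sum_sum.
under eq_bigr => q _ do rewrite orbit_sumZ orbit_sum_pact.
have [a [a0 ca]] := cell_surj muN mu0; have [b [b1 cb]] := cell_surj muN mu1.
have ab : a != b by apply/eqP => e; move: b1; rewrite -e a0.
have := @antisym_fixed_eq0 R V _ pact (@pactM R N) (cell_col mu) setT a b
  (orbit_sum (f g)) (in_setT a) (in_setT b) ab.
rewrite /cell_col ca cb pact_orbit_sum => /(_ erefl erefl).
rewrite -/(col_sum mu _) col_sumE => {2}<-.
by apply: eq_bigr => q _; rewrite pact_orbit_sum.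
Qed.

Lemma orbit_sum_specht_row (u : V) :
  in_specht [:: N] u -> orbit_sum u = #|{: {perm 'I_N}}|%:R *: u.
Proof.
move=> [f uE].
suff fix_u p : pact p u = u.
  rewrite /orbit_sum; under eq_bigr do rewrite fix_u.
  by rewrite sumr_const scaler_nat.
rewrite uE linear_sum; apply: eq_bigr => g _; rewrite fact_pact ystE.
suff -> : row_sum [:: N] (col_sum [:: N] (f g)) = orbit_sum (col_sum [:: N] (f g)).
  by rewrite !pact_orbit_sum.
apply: eq_bigl => q; apply/forallP => x /=.
by rewrite !ltn_ord.
Qed.

End Operators.

Section Main.

Context (R : realFieldType).
Local Notation pact := (@pact R _).

(* The vector (B - beta) (B v) is row-fixed and orthogonal to all the relevant
   Specht modules, so it vanishes, and |B v|^2 = beta <v, B v> = 0. *)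
Lemma sym_equivariant_eq0 (n k : nat) (r : 'I_(2 * n) -> nat) (beta : R)
    (B : {ffun matching (2 * n) -> R^o} -> {ffun matching (2 * n) -> R^o})
    (v : {ffun matching (2 * n) -> R^o}) :
    sym_equivariant B ->
    (forall a b, r a = r b -> pact (tperm a b) v = v) ->
    (k <= #|[set x | r x == 0%N]|)%N ->
    (forall lam, is_partition n lam -> (k <= 2 * head 0%N lam)%N ->
       (forall u : {ffun matching (2 * n) -> R^o},
          in_specht (dbl_part lam) u -> B u = 0) \/
       (forall u : {ffun matching (2 * n) -> R^o},
          in_specht (dbl_part lam) u -> B u = beta *: u)) ->
    dot v (B v) = 0 ->
  B v = 0.
Proof.
move=> [Bsym Beq] vrow kr Bspecht vBv.
suff BBv : B (B v) = beta *: B v.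
  by apply: dot_eq0; rewrite Bsym BBv dotZr vBv mulr0.
apply/eqP; rewrite -subr_eq0; apply/eqP; apply: (row_fixed_eq0 _ kr).
  by move=> a b ab; rewrite linearB linearZ /= !Beq vrow.
move=> lam lamn klam; apply: orth_specht_col_row_sum => u uS.
rewrite dotBl dotZl (Bsym (B v)).
case: (Bspecht lam lamn klam) => Bu; rewrite (Bu u uS).
  by rewrite (Bsym v u) (Bu u uS) !dot0r mulr0 subrr.
by rewrite dotZr subrr.
Qed.

End Main.

(** * Matchings with prescribed edges *)

Lemma card_ord_lt N k : (k <= N)%N -> #|[set x : 'I_N | (x < k)%N]| = k.
Proof.
move=> kN; rewrite -[RHS]card_ord -cardsT -(card_imset _ (f := widen_ord kN)).
  apply: eq_card => x; rewrite inE; apply/idP/imsetP => [xk|[y _ ->] //=].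
  by exists (Ordinal xk) => //; apply: val_inj.
by move=> x y /(congr1 val) /= e; apply: val_inj.
Qed.

Section EdgeFamily.

Context (R : realFieldType) (N : nat).
Local Notation M := (matching N).
Local Notation V := {ffun M -> R^o}.
Local Notation pact := (@pact R N).

(* For even k: m contains the edges {k, k+1}, {k+2, k+3}, ... *)
Definition edges_from (k : nat) (m : M) : bool :=
  [forall x : 'I_N, (k <= x)%N ==> ((val m x)./2 == x./2)].

Definition edge_ind (k : nat) : V := [ffun m => (edges_from k m)%:R].

Lemma edges_fromP k (m : M) :
  reflect (forall x : 'I_N, (k <= x)%N -> (val m x)./2 = x./2) (edges_from k m).
Proof.
apply: (iffP forallP) => H x; first by move=> kx; apply/eqP; have := H x; rewrite kx.
by apply/implyP => /H ->.
Qed.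

Lemma edges_from_partner k (m : M) (x : 'I_N) : edges_from k m -> (k <= x)%N ->
  val m x = (if odd x then x.-1 else x.+1) :> nat.
Proof.
move=> /edges_fromP mk /mk; have : (val m x != x :> nat) by exact: matching_neq.
case: ifP; lia.
Qed.

(** Evenness of [k] keeps each pair [{2i, 2i+1}] on one side of [k], so [p] maps every prescribed
    edge to itself. *)
Lemma edges_from_mact k (p : {perm 'I_N}) (m : M) : ~~ odd k ->
    (forall x : 'I_N, (k <= x)%N -> (p x)./2 = x./2) ->
    (forall x : 'I_N, (k <= x)%N -> (p^-1%g x)./2 = x./2) ->
  edges_from k (mact p m) = edges_from k m.
Proof.
move=> ek.
have sub (q : {perm 'I_N}) m' : (forall x : 'I_N, (k <= x)%N -> (q x)./2 = x./2) ->
    (forall x : 'I_N, (k <= x)%N -> (q^-1%g x)./2 = x./2) ->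
    edges_from k m' -> edges_from k (mact q m').
  move=> qk qVk /edges_fromP mk; apply/edges_fromP => x kx.
  have e1 := qVk x kx; set w := q^-1%g x in e1.
  have kw : (k <= w)%N by lia.
  have e2 := mk w kw; have kmw : (k <= val m' w)%N by lia.
  by rewrite -[x in LHS](permKV q) mactE -/w qk // e2 e1.
move=> pk pVk; apply/idP/idP => [|]; last exact: sub.
by move=> /(sub p^-1%g); rewrite invgK mactK; apply.
Qed.

(** The labelling puts the vertices below [k] in row 0 and each other vertex alone in its row: its
    Young subgroup is the symmetric group on the vertices below [k]. *)
Lemma edge_ind_row_fixed k : ~~ odd k ->
  forall a b : 'I_N, (if a < k then 0 else a.+1)%N = (if b < k then 0 else b.+1)%N ->
  pact (tperm a b) (edge_ind k) = edge_ind k.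
Proof.
move=> ek a b; case: (ltnP a k) => ak; case: (ltnP b k) => bk // ab; last first.
  by move: ab => -[/val_inj ->]; rewrite tperm1 pact1.
have fixp (x : 'I_N) : (k <= x)%N -> tperm a b x = x.
  by move=> kx; rewrite tpermD //; apply/eqP => e; move: kx; rewrite -e leqNgt ?ak ?bk.
apply/ffunP => m; rewrite pactE !ffunE edges_from_mact // => x kx.
  by rewrite fixp.
by rewrite tpermV fixp.
Qed.

(** The matchings on the left are sorted by the partner [y] of [x0 = 2j+1], which has [2j+1]
    possible values. The resulting indicators [f y] are all translates of [f y0] with [y0 = 2j], and
    [f y0] prescribes one edge more. *)
Lemma orbit_sum_edge_ind_step j : (j.*2.+1 < N)%N ->
  orbit_sum (edge_ind j.*2.+2) = j.*2.+1%:R *: orbit_sum (edge_ind j.*2).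
Proof.
move=> jN; pose x0 := Ordinal jN; pose y0 := Ordinal (ltnW jN).
pose f (y : 'I_N) : V := [ffun m => (edges_from j.*2.+2 m && (val m x0 == y))%:R].
have fy0 : f y0 = edge_ind j.*2.
  apply/ffunP => m; rewrite !ffunE; congr (nat_of_bool _)%:R.
  apply/andP/idP => [[/edges_fromP mj /eqP mx0]|mj].
    apply/edges_fromP => x; rewrite leq_eqVlt => /orP[/eqP jx|].
      have -> : x = y0 by apply: val_inj.
      by rewrite -mx0 matchingK mx0 /=; lia.
    rewrite leq_eqVlt => /orP[/eqP jx|]; last exact: mj.
    have -> : x = x0 by apply: val_inj.
    by rewrite mx0 /=; lia.
  split; last first.
    apply/eqP/ord_inj; rewrite (edges_from_partner mj) /=; last by lia.
    by rewrite odd_double.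
  by apply/edges_fromP => x jx; move/edges_fromP: mj; apply; lia.
have fy (y : 'I_N) : (y < j.*2.+2)%N && (y != x0) ->
    orbit_sum (f y) = orbit_sum (edge_ind j.*2).
  move=> /andP[yj yx0]; rewrite -fy0 -[RHS](orbit_sum_pact (tperm y y0)).
  congr orbit_sum; apply/ffunP => m; rewrite pactE !ffunE.
  have fixp (x : 'I_N) : (j.*2.+2 <= x)%N -> tperm y y0 x = x.
    move=> kx; rewrite tpermD //; apply/eqP => e; move: kx; rewrite -e; first by lia.
    by rewrite /=; lia.
  rewrite edges_from_mact; last 3 first.
  - by rewrite /= odd_double.
  - by move=> x /fixp ->.
  - by move=> x /fixp; rewrite tpermV => ->.
  congr (nat_of_bool (_ && _))%:R.
  have {2}<- : tperm y y0 x0 = x0 by rewrite tpermD // -val_eqE /= ltn_eqF.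
  by rewrite mactE -[in RHS](inj_eq (@perm_inj _ (tperm y y0))) tpermK tpermR.
have -> : edge_ind j.*2.+2 = \sum_(y : 'I_N | (y < j.*2.+2)%N && (y != x0)) f y.
  apply/ffunP => m; rewrite sum_ffunE ffunE; under eq_bigr do rewrite ffunE.
  case: (boolP (edges_from j.*2.+2 m)) => mj /=; last by rewrite big1.
  rewrite (bigD1 (val m x0)) /= ?eqxx ?matching_neq ?andbT.
    rewrite big1 ?addr0 // => y /andP[_ yx]; by rewrite eq_sym (negbTE yx).
  rewrite ltnNge; apply/negP => jm; move/edges_fromP: mj => /(_ _ jm).
  by rewrite matchingK /=; lia.
rewrite orbit_sum_sum (eq_bigr _ fy) sumr_const scaler_nat; congr (_ *+ _).
have -> : #|[pred y : 'I_N | (y < j.*2.+2)%N && (y != x0)]| =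
    #|[set y : 'I_N | (y < j.*2.+2)%N] :\ x0|.
  by apply: eq_card => y; rewrite !inE andbC.
have := cardsD1 x0 [set y : 'I_N | (y < j.*2.+2)%N].
by rewrite card_ord_lt // inE ltnSn add1n => -[].
Qed.

End EdgeFamily.

Section EvenVertices.

Context (R : realFieldType) (n : nat).
Local Notation edge_ind := (@edge_ind R (2 * n)).
Local Notation M := (matching (2 * n)).

(** For [s = 0] the indicator is the constant 1, and each further edge divides by the next odd
    number. Thus the invariant part of the indicator is the inverse of the product. *)
Lemma orbit_sum_edge_ind s (m : M) : (s <= n)%N ->
  (\prod_(k < s) (2 * n - 1 - 2 * k))%N%:R * orbit_sum (edge_ind (n - s).*2) m
    = #|{: {perm 'I_(2 * n)}}|%:R.
Proof.
elim: s => [_|s IH sn].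
  rewrite big_ord0 mul1r subn0 /orbit_sum sum_ffunE.
  under eq_bigr => p _.
    rewrite pactE ffunE; have -> : edges_from n.*2 (mact p m).
      by apply/edges_fromP => x; rewrite leqNgt -mul2n ltn_ord.
    over.
  by rewrite sumr_const.
rewrite -(IH (ltnW sn)) big_ord_recr /= natrM -mulrA; congr (_ * _).
have -> : ((n - s).*2 = (n - s.+1).*2.+2)%N by lia.
rewrite orbit_sum_edge_ind_step ?ffunE; last by lia.
by congr (_%:R * _); lia.
Qed.

Lemma dot_edge_ind_assoc_op t rho : (t <= n)%N -> (count_mem 1%N rho < t)%N ->
  dot (edge_ind (n - t).*2) (assoc_op rho (edge_ind (n - t).*2)) = 0.
Proof.
move=> tn rho_t; apply: big1 => m _; rewrite !ffunE.
case: (boolP (edges_from _ m)) => [mt|_]; last by rewrite mul0r.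
rewrite mul1r big1 // => m' /eqP mm'; rewrite ffunE.
case: (boolP (edges_from _ m')) => // mt'; move: rho_t; rewrite -mm' ltnNge => /negP[].
(* The even endpoint of each of the [t] prescribed edges, all of them common to [m] and [m']. *)
pose A := [set x : 'I_(2 * n) | ((n - t).*2 <= x)%N && ~~ odd x].
have tA : (t <= #|A|)%N.
  have lt (i : 'I_t) : ((n - t).*2 + i.*2 < 2 * n)%N by have := ltn_ord i; lia.
  rewrite -[X in (X <= _)%N]card_ord -cardsT -(card_imset _ (f := fun i => Ordinal (lt i))).
    apply: subset_leq_card; apply/subsetP => _ /imsetP[i _ ->].
    by rewrite inE /= leq_addr oddD !odd_double.
  by move=> i j /(congr1 val) /= e; apply: val_inj => /=; lia.
apply: (leq_trans tA); apply: count1_cycle_type => [x|x y].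
  rewrite inE => /andP[xt _]; apply: ord_inj.
  by rewrite (edges_from_partner mt xt) (edges_from_partner mt' xt).
rewrite !inE => /andP[xt xe] /andP[_ ye]; rewrite -val_eqE /=.
have := edges_from_partner mt xt; rewrite (negbTE xe) /= => ->.
by apply: contraNneq ye => <-; rewrite /= xe.
Qed.

Lemma flip_subproof (x : 'I_(2 * n)) : ((if odd x then x.-1 else x.+1) < 2 * n)%N.
Proof. by have := ltn_ord x; case: ifP; lia. Qed.

Definition flip (x : 'I_(2 * n)) : 'I_(2 * n) := Ordinal (flip_subproof x).

Lemma flipK : involutive flip.
Proof.
by move=> x; apply: val_inj => /=; case: ifP; case: ifP; lia.
Qed.

Definition flip_perm : {perm 'I_(2 * n)} := perm (inv_inj flipK).

Lemma flip_perm_is_pm : is_pm flip_perm.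
Proof.
apply/forallP => x; rewrite !permE flipK eqxx andbT -val_eqE /=.
by case: ifP; lia.
Qed.

(** The point at which the column sum of [edge_ind] will be evaluated; it contains the prescribed
    edges. *)
Definition flip_matching : M := exist _ flip_perm flip_perm_is_pm.

Lemma flip_matchingE x : val flip_matching x = flip x.
Proof. by rewrite permE. Qed.

(* q = q0 * (q0 ^ flip) where q0 is the restriction of q to the even points. *)
Lemma odd_perm_flip_commute (q : {perm 'I_(2 * n)}) :
    (forall x, odd (q x) = odd x) -> (forall x, q (flip x) = flip (q x)) ->
  odd_perm q = false.
Proof.
move=> q_par q_flip.
pose h (x : 'I_(2 * n)) := if odd x then x else q x.
have h_inj : injective h.
  move=> x y; rewrite /h; case: ifP => ox; case: ifP => oy e //.
  - by move: ox; rewrite e q_par oy.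
  - by move: oy; rewrite -e q_par ox.
  - exact: perm_inj e.
have odd_flip (x : 'I_(2 * n)) : odd (flip x) = ~~ odd x.
  by rewrite /=; case: ifP; lia.
pose q0 := perm h_inj.
have -> : q = (q0 * q0 ^ flip_perm)%g.
  apply/permP => x; rewrite permM.
  have -> : q0 x = flip_perm (flip (q0 x)) by rewrite [RHS]permE flipK.
  rewrite permJ.
  rewrite !permE; case: (boolP (odd x)) => ox.
    have -> : h x = x by rewrite /h ox.
    by rewrite /h odd_flip ox q_flip flipK.
  have -> : h x = q x by rewrite /h (negbTE ox).
  by rewrite /h odd_flip q_par ox flipK.
by rewrite odd_permM odd_permJ addbb.
Qed.

End EvenVertices.

(** * The hook component *)

Lemma cell_nseq2 t x : (x < t.*2)%N -> cell (nseq t 2%N) x = (x./2, odd x : nat).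
Proof.
elim: t x => [|t IH] [|[|x]] //= xt.
by rewrite !subSS subn0 IH ?negbK.
Qed.

Lemma dbl_hook n t : dbl_part (hook n t) = (2 * (n - t))%N :: nseq t 2%N.
Proof. by rewrite /dbl_part /hook /= map_nseq. Qed.

(** The rows below the first one are exactly the prescribed edges [{2i, 2i+1}], which ties the
    indicator to this shape. *)
Lemma cell_dbl_hook n t (x : nat) : (t <= n)%N -> (x < 2 * n)%N ->
  cell (dbl_part (hook n t)) x =
    if (x < (n - t).*2)%N then (0%N, x) else ((x./2 - (n - t)).+1, odd x : nat).
Proof.
move=> tn xn; rewrite dbl_hook /= mul2n; case: ltnP => // kx.
by rewrite cell_nseq2 /=; [congr (_, _); lia | lia].
Qed.

Section HookComponent.

Context (R : realFieldType) (n t : nat) (tn : (t < n)%N).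
Local Notation mu := (dbl_part (hook n t)).
Local Notation k := (n - t).*2.
Local Notation pact := (@pact R _).
Local Notation M := (matching (2 * n)).

Let cellE (x : 'I_(2 * n)) := cell_dbl_hook (ltnW tn) (ltn_ord x).

Lemma edge_ind_rowstab (p : {perm 'I_(2 * n)}) :
  rowstab mu p -> pact p (edge_ind R (2 * n)%N k) = edge_ind R (2 * n)%N k.
Proof.
have half (q : {perm 'I_(2 * n)}) : rowstab mu q ->
    forall x : 'I_(2 * n), (k <= x)%N -> (q x)./2 = x./2.
  move=> /forallP q_row x kx; have := q_row x.
  rewrite !cellE [in X in _ == X]ltnNge kx /=.
  by case: ltnP => //= kq /eqP; lia.
move=> p_row; apply/ffunP => m; rewrite pactE !ffunE edges_from_mact //.
- by rewrite odd_double.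
- exact: half.
- by apply: half; rewrite rowstabV.
Qed.

(* Such a q commutes with the flip, so it acts identically on the first two
   columns and is even: the nonzero terms of col_sum at flip_matching are 1. *)
Lemma colstab_edges_even (q : {perm 'I_(2 * n)}) : colstab mu q ->
  edges_from k (mact q (flip_matching n)) -> odd_perm q = false.
Proof.
move=> /forallP q_col qk.
pose col (x : 'I_(2 * n)) := if (x < k)%N then (x : nat) else odd x : nat.
have colq x : col (q x) = col x.
  have := q_col x; rewrite !cellE /col.
  by case: ifP => _; case: ifP => _ /eqP.
have odd_col (x : 'I_(2 * n)) : odd (col x) = odd x.
  by rewrite /col; case: ifP => // _; rewrite oddb.
have q_par x : odd (q x) = odd x by rewrite -odd_col colq odd_col.
have flipE (x : 'I_(2 * n)) : flip x = (if odd x then x.-1 else x.+1) :> nat by [].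
have low_inj (x y : 'I_(2 * n)) : (x < k)%N -> (y < k)%N -> col x = col y -> x = y.
  by rewrite /col => -> -> e; apply: ord_inj.
have q_high x : (k <= q x)%N -> q (flip x) = flip (q x).
  move=> kqx; apply: ord_inj; rewrite flipE -(edges_from_partner qk kqx).
  by rewrite mactE flip_matchingE.
have flip_low (x : 'I_(2 * n)) : (flip x < k)%N = (x < k)%N.
  by rewrite flipE; case: ifP; lia.
apply: odd_perm_flip_commute => // x.
case: (leqP k (q x)) => [/q_high //|qxk].
(* A column of index at least 2 is a single cell of the first row, so [q] fixes its point. *)
have [c2|c2] := leqP 2 (col x).
  have fixq (y : 'I_(2 * n)) : (2 <= col y)%N -> q y = y.
    move=> cy; have low (z : 'I_(2 * n)) : (2 <= col z)%N -> (z < k)%N.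
      by rewrite /col; case: ifP => // _; case: odd.
    by apply: low_inj; rewrite ?low ?colq.
  rewrite !fixq //; move: c2; rewrite /col flip_low; case: ifP => [_|_].
    by rewrite flipE; case: ifP; lia.
  by case: odd.
have [qfk|qfk] := ltnP (q (flip x)) k; last first.
  have := q_high (flip x) qfk; rewrite flipK => e.
  by move: qxk; rewrite e flip_low ltnNge qfk.
(* The flip exchanges columns 0 and 1. Both [q x] and [q (flip x)] are now in the first row, where a
   point is determined by its column. *)
have col_flip y : (col y < 2)%N -> col (flip y) = (1 - col y)%N.
  rewrite /col flip_low; case: ifP => _; first by rewrite flipE; case: ifP; lia.
  have -> : odd (flip y) = ~~ odd y by rewrite flipE; case: ifP; lia.
  by case: odd.
by apply: low_inj; rewrite ?flip_low // colq !col_flip ?colq.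
Qed.

Lemma col_sum_edge_ind_neq0 : col_sum mu (edge_ind R (2 * n)%N k) != 0.
Proof.
apply/eqP => /(congr1 (fun f : {ffun M -> R^o} => f (flip_matching n))).
apply/eqP; rewrite col_sumE sum_ffunE ffunE.
have term (q : {perm 'I_(2 * n)}) : colstab mu q ->
    ((-1) ^+ odd_perm q *: pact q (edge_ind R (2 * n)%N k)) (flip_matching n) =
    (edges_from k (mact q (flip_matching n)))%:R.
  move=> q_col; rewrite ffunE pactE ffunE.
  case: (boolP (edges_from _ _)) => [/(colstab_edges_even q_col) ->|_].
    by rewrite expr0 scale1r.
  by rewrite scaler0.
rewrite (eq_bigr _ term) (bigD1 1%g) /=; last first.
  by apply/forallP => x; rewrite perm1.
have -> : edges_from k (mact 1%g (flip_matching n)).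
  rewrite mact1; apply/edges_fromP => x _; rewrite flip_matchingE /=.
  by case: ifP; lia.
by rewrite lt0r_neq0 // ltr_wpDr ?ltr01 // sumr_ge0 // => q _; rewrite ler0n.
Qed.

(** Row permutations fix the indicator, so [col_sum] of its row sum is a positive multiple of a
    nonzero vector, while orthogonality would make it zero. *)
Lemma edge_ind_not_orth_hook :
  ~ (forall u : {ffun M -> R^o}, in_specht mu u -> dot (edge_ind R (2 * n)%N k) u = 0).
Proof.
move=> /orth_specht_col_row_sum /(_ 1%g); rewrite pact1.
have -> : row_sum mu (edge_ind R (2 * n)%N k) =
    \sum_(p : {perm 'I_(2 * n)} | rowstab mu p) edge_ind R (2 * n)%N k.
  by apply: eq_bigr => p; exact: edge_ind_rowstab.
rewrite /col_sum antisym_sum sumr_const -/(col_sum mu _) => /eqP.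
rewrite -scaler_nat scaler_eq0 (negbTE col_sum_edge_ind_neq0) orbF pnatr_eq0.
move=> /eqP/card0_eq/(_ 1%g); rewrite inE => /forallP[] x.
by rewrite perm1.
Qed.

End HookComponent.

(** * The eigenvalue on the hook *)

Section Combination.

Context (R : realFieldType) (n t : nat) (t0 : (0 < t)%N) (tn : (2 * t < n)%N).
Context (ps : seq (seq nat)) (x : 'I_(size ps) -> R).
Context (srt : sorted revlex_gt ps).
Context (mem_ps :
  forall lam, (lam \in ps) = is_partition n lam && revlex_gt lam (hook n t)).

Local Notation V := {ffun matching (2 * n) -> R^o}.
Local Notation k := (n - t).*2.
Local Notation v := (edge_ind R (2 * n)%N k).
Local Notation D := (\prod_(k < t) (2 * n - 1 - 2 * k))%N.
Local Notation card_perm := (#|{: {perm 'I_(2 * n)}}|%:R : R).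

Definition weighted_assoc (f : V) : V :=
  \sum_(j < size ps) x j *: (assoc_op (nth [::] ps j) f : V).

(** The subtracted operator has eigenvalue 1 on the invariant vectors and [zeta n t] on their
    complement. The difference vanishes on the modules above the hook and is [eta - zeta n t] on the
    hook. *)
Definition shifted_assoc (f : V) : V :=
  weighted_assoc f -
    (zeta n t *: f + ((1 - zeta n t) / card_perm) *: orbit_sum f).

Let tn' : (t < n)%N.
Proof. lia. Qed.

Lemma card_perm_neq0 : card_perm != 0.
Proof. by rewrite pnatr_eq0 -lt0n; apply/card_gt0P; exists 1%g. Qed.

Lemma nth_ps_partition (j : 'I_(size ps)) :
  is_partition n (nth [::] ps j) /\ revlex_gt (nth [::] ps j) (hook n t).
Proof. by apply/andP; rewrite -mem_ps mem_nth. Qed.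

Lemma sumn_dbl_part lam : is_partition n lam -> sumn (dbl_part lam) = (2 * n)%N.
Proof.
move=> /and3P[_ _ /eqP <-].
by rewrite /dbl_part !sumnE big_map big_distrr.
Qed.

Lemma orbit_sum_not_row lam (u : V) : is_partition n lam -> lam != [:: n] ->
  in_specht (dbl_part lam) u -> orbit_sum u = 0.
Proof.
move=> lam_n lamN; apply: orbit_sum_specht_eq0; first exact: sumn_dbl_part.
  move: lam_n => /and3P[_]; case: (lam) => [|a l] /=; first by move=> _ /eqP; lia.
  by move=> /andP[a0 _] _; rewrite muln_gt0.
move: lam_n lamN => /and3P[_]; case: (lam) => [|a [|b l]] /=.
- by move=> _ /eqP; lia.
- by move=> _ /eqP <-; rewrite addn0 eqxx.
- by move=> /and3P[_ b0 _] _ _; rewrite muln_gt0.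
Qed.

Lemma shifted_assoc_sym_equivariant : sym_equivariant shifted_assoc.
Proof.
have [osym oeq] := @orbit_sum_sym_equivariant R (2 * n)%N.
have asym rho := (@assoc_op_sym_equivariant R (2 * n)%N rho).1.
have aeq rho := (@assoc_op_sym_equivariant R (2 * n)%N rho).2.
split=> [f g|p f].
  rewrite /shifted_assoc dotBl dotBr; congr (_ - _).
    rewrite /weighted_assoc dot_suml dot_sumr; apply: eq_bigr => j _.
    by rewrite dotZl dotZr asym.
  by rewrite dotC !dotDr !dotZr (dotC g f) (dotC g (orbit_sum f)) osym.
rewrite /shifted_assoc linearB linearD !linearZ /= oeq /weighted_assoc linear_sum.
by congr (_ - _); apply: eq_bigr => j _; rewrite linearZ /= aeq.
Qed.

(** [weighted_assoc] contributes 0, and the rest is [dot v v] times [zeta + (1 - zeta) / D] up to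
    sign, which vanishes for [zeta = -1 / (D - 1)]. *)
Lemma dot_edge_ind_shifted_assoc : dot v (shifted_assoc v) = 0.
Proof.
(* The factor of index 0, present since [t > 0], is [2n - 1 > 1]; so the inverse in [zeta] is a
   genuine one. *)
have D1 : (1 < D)%N.
  have [s st] : exists s, t = s.+1 by exists t.-1; lia.
  rewrite st big_ord_recl /= muln0 subn0.
  have : (0 < \prod_(i < s) (2 * n - 1 - 2 * bump 0 i))%N.
    by rewrite prodn_cond_gt0 // => i _; have := ltn_ord i; rewrite /bump /=; lia.
  by move=> p0; apply: (@leq_trans (2 * n - 1)); [lia | rewrite leq_pmulr].
have D0 : (D%:R : R) != 0 by rewrite pnatr_eq0; lia.
have D10 : (D%:R - 1 : R) != 0 by rewrite -(natrB _ (ltnW D1)) pnatr_eq0; lia.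
have orbE m : orbit_sum v m = card_perm / D%:R.
  by rewrite -(orbit_sum_edge_ind R m (ltnW tn')) mulrAC mulfV ?mul1r.
have weighted0 : dot v (weighted_assoc v) = 0.
  rewrite dot_sumr big1 // => j _; rewrite dotZr dot_edge_ind_assoc_op ?mulr0 //.
    exact: ltnW.
  by have [p1 p2] := nth_ps_partition j; apply: count1_above_hook p1 p2.
have orb : dot v (orbit_sum v) = dot v v * (card_perm / D%:R).
  rewrite mulr_suml; apply: eq_bigr => m _; rewrite orbE ffunE.
  by case: edges_from; rewrite ?mul1r ?mul0r.
rewrite /shifted_assoc dotBr weighted0 dotDr !dotZr orb.
rewrite /zeta; have := card_perm_neq0; set c := card_perm => c0.
by field; rewrite c0 D0.
Qed.

(** * Eigenvalues on the modules of fat partitions *)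

Section Eigenvalues.

Context (P : seq nat -> seq nat -> R).
Context (P_eig : forall lam rho, is_partition n lam -> is_partition n rho ->
  forall u : V, in_specht (dbl_part lam) u ->
    (assoc_op rho u : V) = P lam rho *: u).
Context (P_sys : forall i : 'I_(size ps),
  \sum_(j < size ps) x j * P (nth [::] ps i) (nth [::] ps j)
    = if val i == 0%N then 1 else zeta n t).

Lemma weighted_assoc_specht lam (u : V) : is_partition n lam ->
    in_specht (dbl_part lam) u ->
  weighted_assoc u = (\sum_(j < size ps) x j * P lam (nth [::] ps j)) *: u.
Proof.
move=> lam_n uS; rewrite scaler_suml; apply: eq_bigr => j _.
by rewrite (P_eig lam_n (nth_ps_partition j).1 uS) scalerA.
Qed.

Let eta := \sum_(j < size ps) x j * P (hook n t) (nth [::] ps j).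

Lemma shifted_assoc_above (i : 'I_(size ps)) (u : V) :
  in_specht (dbl_part (nth [::] ps i)) u -> shifted_assoc u = 0.
Proof.
move=> uS; have [lam_n _] := nth_ps_partition i.
rewrite /shifted_assoc (weighted_assoc_specht lam_n uS) P_sys.
have t0n : (0 < t < n)%N by rewrite t0 tn'.
rewrite -[val i == 0%N](head_above_hook t0n srt mem_ps (ltn_ord i)).
case: eqP uS => [->|/eqP i_row] uS.
  rewrite (orbit_sum_specht_row uS) scalerA -scalerDl divfK ?card_perm_neq0 //.
  by rewrite [zeta n t + _]addrC subrK subrr.
by rewrite (orbit_sum_not_row lam_n i_row uS) scaler0 addr0 subrr.
Qed.

Lemma shifted_assoc_hook (u : V) :
  in_specht (dbl_part (hook n t)) u -> shifted_assoc u = (eta - zeta n t) *: u.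
Proof.
move=> uS; have hook_n := hook_is_partition tn'.
rewrite /shifted_assoc (weighted_assoc_specht hook_n uS).
rewrite (orbit_sum_not_row hook_n _ uS) ?scaler0 ?addr0 ?scalerBl //.
by rewrite /hook; case: (t) t0 => // s _; rewrite eqseq_cons andbF.
Qed.

Lemma hook_eigenvalue : eta = zeta n t.
Proof.
have Bv0 : shifted_assoc v = 0.
  apply: (sym_equivariant_eq0 (k := k) (beta := eta - zeta n t) shifted_assoc_sym_equivariant
    (edge_ind_row_fixed (k := k) R _)).
  - by rewrite odd_double.
  - rewrite -{1}(@card_ord_lt (2 * n) k); last by lia.
    by apply: subset_leq_card; apply/subsetP => y; rewrite !inE => ->.
  - move=> lam lam_n klam.
    have fat : (n - t <= head 0%N lam)%N by lia.
    case: (fat_partition tn' lam_n fat) => [gt|->]; [left|right].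
      have : lam \in ps by rewrite mem_ps lam_n.
      move=> /(nthP [::])[i ips <-].
      exact: (@shifted_assoc_above (Ordinal ips)).
    exact: shifted_assoc_hook.
  - exact: dot_edge_ind_shifted_assoc.
(* Were [eta - zeta n t] nonzero, self-adjointness and [shifted_assoc v = 0] would make [v]
   orthogonal to the hook module. *)
apply/eqP; rewrite -subr_eq0; apply/negPn/negP => beta0.
apply: (@edge_ind_not_orth_hook R n t tn') => u uS.
apply: (mulfI beta0); rewrite mulr0 -dotZr -shifted_assoc_hook //.
by rewrite -shifted_assoc_sym_equivariant.1 Bv0 dotC dot0r.
Qed.

End Eigenvalues.

End Combination.

Theorem mainTheorem6 (R : realFieldType) (n t : nat)
    (P : seq nat -> seq nat -> R) (ps : seq (seq nat))
    (x : 'I_(size ps) -> R) :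
  (2 * t < n)%N ->
  (forall lam rho, is_partition n lam -> is_partition n rho ->
     forall v : {ffun matching (2 * n) -> R},
       in_specht (dbl_part lam) v -> assoc_op rho v = scalef (P lam rho) v) ->
  sorted revlex_gt ps ->
  (forall lam, (lam \in ps) = is_partition n lam && revlex_gt lam (hook n t)) ->
  (forall i : 'I_(size ps),
     \sum_(j < size ps) x j * P (nth [::] ps i) (nth [::] ps j)
       = if val i == 0%N then 1 else zeta n t) ->
  (forall v : {ffun matching (2 * n) -> R},
     in_specht (dbl_part (hook n t)) v ->
     \sum_(j < size ps) scalef (x j) (assoc_op (nth [::] ps j) v)
       = scalef (zeta n t) v)
  /\ \sum_(j < size ps) x j * P (hook n t) (nth [::] ps j) = zeta n t.
Proof.
move=> tn P_eig srt mem_ps P_sys.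
have P_eig' lam rho : is_partition n lam -> is_partition n rho ->
    forall u : {ffun matching (2 * n) -> R^o}, in_specht (dbl_part lam) u ->
    (assoc_op rho u : {ffun matching (2 * n) -> R^o}) = P lam rho *: u.
  by move=> lam_n rho_n u uS; rewrite -scalefE; apply: P_eig.
suff eta_zeta : \sum_(j < size ps) x j * P (hook n t) (nth [::] ps j) = zeta n t.
  split=> // u uS; rewrite -eta_zeta [RHS]scalefE.
  have hook_n : is_partition n (hook n t) by apply: hook_is_partition; lia.
  rewrite -(weighted_assoc_specht x mem_ps P_eig' hook_n uS).
  by apply: eq_bigr => j _; rewrite -scalefE.
case: (posnP t) => [t0|t0]; last first.
  exact: (hook_eigenvalue (x := x) t0 tn srt mem_ps P_eig' P_sys).
(* for t = 0, zeta n 0 = - 0^-1 = 0 is the value of the empty sum *)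
have ps0 : ps = [::].
  case: (ps) mem_ps => // lam ps' /(_ lam); rewrite inE eqxx /= => /esym/andP[].
  move=> /and3P[_ + /eqP]; rewrite t0 /hook subn0 /=.
  case: lam => //= a l /andP[_ l_pos] <-; case: l l_pos => [|b l] /=.
    by rewrite addn0 ltnn eqxx.
  by move=> /andP[b0 _]; case/orP => [|/andP[/eqP]]; lia.
rewrite big1 => [|j _]; last by have := ltn_ord j; rewrite {2}ps0.
by rewrite /zeta t0 big_ord0 subrr invr0 oppr0.
Qed.
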